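(* Let $\mathbb{T}$ be a time scale that is unbounded above and has bounded graininess, with $0\in\mathbb{T}$, and let $A\in\mathbb{R}^{n\times n}$, $B\in\mathbb{R}^{n\times m}$, $C\in\mathbb{R}^{p\times n}$ be constant matrices with $A$ regressive. Suppose the time invariant regressive linear system $$x^{\Delta}(t)=Ax(t)+Bu(t),\qquad y(t)=Cx(t),$$ is a realization of the transfer function $G(z)$. Then this state equation is a minimal realization of $G(z)$ if and only if it is both controllable and observable.
   Context: A time scale $\mathbb{T}$ is a nonempty closed subset of $\mathbb{R}$, with forward jump operator $\sigma(t)=\inf\{s\in\mathbb{T}:s>t\}$ and graininess $\mu(t)=\sigma(t)-t$; $f^\Delta$ denotes the delta derivative. Intervals are understood to be intersected with $\mathbb{T}$. A function is rd-continuous if it is continuous at right-dense points of $\mathbb{T}$ and has finite left limits at left-dense points. A constant matrix $A$ (or the system) is regressive if $I+\mu(t)A$ is invertible for all $t\in\mathbb{T}$; all systems in question are regressive. The system is a (time invariant) realization, of dimension $n$, of the transfer function $G(z)$ (a $p\times m$ matrix of functions of the complex variable $z$) if $C(zI-A)^{-1}B=G(z)$. It is a minimal realization if no time invariant realization of $G(z)$ of dimension less than $n$ exists. The initial time is $t_0=0$. The system is controllable on $[t_0,t_f]$ if for every initial state $x(t_0)=x_0\in\mathbb{R}^n$ and every prescribed final state $x_f\in\mathbb{R}^n$ there exists an rd-continuous input $u(t)$ such that the corresponding solution satisfies $x(t_f)=x_f$; it is observable on $[t_0,t_f]$ if, with zero input, any initial state $x(t_0)=x_0$ is uniquely determined by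 the corresponding response $y(t)$ for $t\in[t_0,t_f)$. ''Controllable'' (respectively ''observable''), with no interval mentioned, means controllable (respectively observable) on $[t_0,t_f]$ for some $t_f\in\mathbb{T}$ with $t_f>t_0$. *)

(* Defs.v *)
From HB Require Import structures.
From mathcomp Require Import all_boot all_order all_algebra.
From mathcomp Require Import all_classical all_reals all_analysis.
From mathcomp Require Import complex.

Set Implicit Arguments.
Unset Strict Implicit.
Unset Printing Implicit Defensive.

Import Order.TTheory GRing.Theory Num.Theory.
Import numFieldNormedType.Exports.

Local Open Scope classical_set_scope.
Local Open Scope ring_scope.

Definition time_scale (R : realType) (T : set R) : Prop :=
  closed T /\ T !=set0.

Definition unbounded_above (R : realType) (T : set R) : Prop :=
  ~ has_ubound T.

(* [inf set0] is 0 in the library, so this is the forward jump operator only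
   at points that are not the maximum of [T]; there is no maximum when [T] is
   unbounded above. *)
Definition fwd_jump (R : realType) (T : set R) (t : R) : R :=
  inf [set s | T s /\ t < s].

Definition graininess (R : realType) (T : set R) (t : R) : R :=
  fwd_jump T t - t.

Definition bounded_graininess (R : realType) (T : set R) : Prop :=
  exists M : R, forall t, T t -> graininess T t <= M.

Definition right_dense (R : realType) (T : set R) (t : R) : Prop :=
  fwd_jump T t = t.

(* The first conjunct excludes the minimum of [T], where the backward jump
   would be the junk value [sup set0]. *)
Definition left_dense (R : realType) (T : set R) (t : R) : Prop :=
  (exists2 s, T s & s < t) /\ sup [set s | T s /\ s < t] = t.

(* Only the values of [f] on [T] matter, here and in [delta_derivative]. *)
Definition rd_continuous (R : realType) (T : set R) (V : normedModType R)
    (f : R -> V) : Prop :=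
  forall t, T t ->
    (right_dense T t -> f @ within T (nbhs t) --> f t) /\
    (left_dense T t -> exists l : V, f @ within T (at_left t) --> l).

(* [L] is the delta derivative of [f] at [t] on the time scale [T]. *)
Definition delta_derivative (R : realType) (T : set R) (V : normedModType R)
    (f : R -> V) (t : R) (L : V) : Prop :=
  forall e : R, 0 < e -> \forall s \near within T (nbhs t),
    `|f (fwd_jump T t) - f s - (fwd_jump T t - s) *: L|
      <= e * `|fwd_jump T t - s|.

Definition regressive (R : realType) (T : set R) (n : nat) (A : 'M[R]_n) :
    Prop :=
  forall t, T t -> 1%:M + graininess T t *: A \in unitmx.

(* The interval [t0, +oo) of the time scale [T], itself a time scale when
   [t0] is in [T]: initial value problems at [t0] are posed on it. *)
Definition from_time (R : realType) (T : set R) (t0 : R) : set R :=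
  T `&` [set t | t0 <= t].

Definition state_solution (R : realType) (T : set R) (t0 : R) (n m : nat)
    (A : 'M[R]_n) (B : 'M[R]_(n, m)) (u : R -> 'cV[R]_m) (x0 : 'cV[R]_n)
    (x : R -> 'cV[R]_n) : Prop :=
  x t0 = x0 /\
  forall t, from_time T t0 t ->
    delta_derivative (from_time T t0) x t (A *m x t + B *m u t).

Definition controllable_on (R : realType) (T : set R) (t0 tf : R) (n m : nat)
    (A : 'M[R]_n) (B : 'M[R]_(n, m)) : Prop :=
  forall x0 xf : 'cV[R]_n, exists u : R -> 'cV[R]_m,
    rd_continuous (from_time T t0) u /\
    exists x : R -> 'cV[R]_n, state_solution T t0 A B u x0 x /\ x tf = xf.

Definition observable_on (R : realType) (T : set R) (t0 tf : R) (n m p : nat)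
    (A : 'M[R]_n) (B : 'M[R]_(n, m)) (C : 'M[R]_(p, n)) : Prop :=
  forall (x0 x0' : 'cV[R]_n) (x x' : R -> 'cV[R]_n),
    state_solution T t0 A B (fun=> 0) x0 x ->
    state_solution T t0 A B (fun=> 0) x0' x' ->
    (forall t, T t -> t0 <= t -> t < tf -> C *m x t = C *m x' t) ->
    x0 = x0'.

(* The initial time is 0. *)
Definition controllable (R : realType) (T : set R) (n m : nat)
    (A : 'M[R]_n) (B : 'M[R]_(n, m)) : Prop :=
  exists tf : R, [/\ T tf, 0 < tf & controllable_on T 0 tf A B].

Definition observable (R : realType) (T : set R) (n m p : nat)
    (A : 'M[R]_n) (B : 'M[R]_(n, m)) (C : 'M[R]_(p, n)) : Prop :=
  exists tf : R, [/\ T tf, 0 < tf & observable_on T 0 tf A B C].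

(* C (z I - A)^-1 B = G(z) as an identity between functions of the complex
   variable z that are only defined off their poles: it is required to hold
   outside some finite set, which must contain the spectrum of [A].  The values
   of [G] at finitely many points are thus irrelevant, as for rational
   functions. *)
Definition realization (R : realType) (n m p : nat)
    (A : 'M[R]_n) (B : 'M[R]_(n, m)) (C : 'M[R]_(p, n))
    (G : R[i] -> 'M[R[i]]_(p, m)) : Prop :=
  exists poles : seq R[i], forall z : R[i], z \notin poles ->
    let zIA := z%:M - map_mx (real_complex R) A in
    zIA \in unitmx /\
    map_mx (real_complex R) C *m invmx zIA *m map_mx (real_complex R) B = G z.

(* The competing systems are regressive on [T], as all systems considered.
   Dimension 0 is allowed: it realizes G = 0. *)
Definition minimal_realization (R : realType) (T : set R) (n m p : nat)
    (A : 'M[R]_n) (B : 'M[R]_(n, m)) (C : 'M[R]_(p, n))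
    (G : R[i] -> 'M[R[i]]_(p, m)) : Prop :=
  realization A B C G /\
  ~ exists k : nat, (k < n)%N /\
      exists (A' : 'M[R]_k) (B' : 'M[R]_(k, m)) (C' : 'M[R]_(p, k)),
        regressive T A' /\ realization A' B' C' G.

(* Main.v *)
(* Markov parameters: equality of transfer functions off a finite set is equality
   of all [C A^k B].  If every [C A^k v = 0] forces [v = 0] and every
   [q A^k B = 0] forces [q = 0], a realization of dimension [k] with the same
   Markov parameters has [k >= n]; otherwise restricting to the reachable
   subspace, or dually, gives a smaller realization, again regressive because
   [I + mu A] restricts to [I + mu A'].

   Rank conditions versus trajectories: an initial time with [n] points of the
   time scale before [tf] lets one differentiate a zero output [n] times, so full
   rank gives observability.  For controllability only exponential inputs
   [det (lam - A) v e_lam(t)], [lam >= 0], are needed: if [q] kills all states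
   reached from 0, then [e_lam(tf) q adj(lam - A) B v = q Phi(tf) adj(lam - A) B v],
   where both products with [adj] are polynomials of degree less than [n] in [lam]
   while [e_lam(tf) >= d lam^n]; hence [q adj(lam - A) B = 0].

   The fundamental matrix [Phi] of a nonnegative [M] is the least function with
   [f(b) >= f(a) + (b - a) M f(a)] for all [a <= b] in the time scale; comparing it
   with majorants [y + s M y + (e^(l s) - 1 - l s) c] gives its delta derivative. *)

Require Import Defs.
From mathcomp Require Import all_boot all_order all_algebra.
From mathcomp Require Import all_classical all_reals all_analysis.
From mathcomp Require Import complex.
From mathcomp Require Import perm polyrcf ring lra.

Set Implicit Arguments.
Unset Strict Implicit.
Unset Printing Implicit Defensive.

Import Order.TTheory GRing.Theory Num.Theory.
Import numFieldNormedType.Exports.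

Local Open Scope classical_set_scope.
Local Open Scope ring_scope.

(** * Transfer functions and Markov parameters *)

Lemma col_mulmx (F : fieldType) (m n p : nat) (A : 'M[F]_(m, n))
    (B : 'M[F]_(n, p)) j : col j (A *m B) = A *m col j B.
Proof. by rewrite !colE mulmxA. Qed.

(** A matrix [W] of maximal rank whose row space lies in [S], up to transposition, captures every
    [v] of [S]: adjoining [v^T] would otherwise raise the rank. The left inverse [L] reads off
    coordinates in the basis [P]. *)
Lemma subspace_basis (F : fieldType) (n : nat) (S : 'cV[F]_n -> Prop) :
  S 0 -> (forall a u v, S u -> S v -> S (a *: u + v)) ->
  exists (k : nat) (P : 'M[F]_(n, k)) (L : 'M[F]_(k, n)),
    L *m P = 1%:M /\ forall v, S v <-> exists w, v = P *m w.
Proof.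
move=> S0 Slin.
pose D (r : nat) := `[< exists W : 'M[F]_n, \rank W = r /\
                  forall v : 'cV[F]_n, (v^T <= W)%MS -> S v >].
have D0 : exists r, D r.
  exists 0%N; apply/asboolP; exists 0; split; first exact: mxrank0.
  by move=> v; rewrite submx0 trmx_eq0 => /eqP ->.
have Dn r : D r -> (r <= n)%N by move=> /asboolP[W [<- _]]; exact: rank_leq_row.
case: (ex_maxnP D0 Dn) => r /asboolP[W [rW SW]] rmax.
exists (\rank W), (row_base W)^T, (pinvmx (row_base W))^T; split.
  by rewrite -trmx_mul mulmxVp ?trmx1 // row_base_free.
move=> v; split=> [Sv|[w ->]]; last first.
  by apply: SW; rewrite trmx_mul trmxK (submx_trans (submxMl _ _)) // eq_row_base.
have [|vW] := boolP (v^T <= W)%MS.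
  rewrite -(eq_row_base W) => /submxP[w vw]; exists w^T.
  by rewrite -trmx_mul -vw trmxK.
have DWv : D (\rank (W + v^T)%MS).
  apply/asboolP; exists (W + v^T)%MS; split=> // w /sub_addsmxP[[a b] /= wab].
  rewrite -[w]trmxK wab linearD /= addrC [b]mx11_scalar mul_scalar_mx.
  rewrite linearZ /= trmxK; apply: Slin => //; apply: SW.
  by rewrite trmxK submxMl.
have := rmax _ DWv; rewrite -rW leqNgt => /negP[].
rewrite rank_ltmx // /ltmx addsmxSl /=; apply: contra vW => h.
by apply: submx_trans h; rewrite addsmxSr.
Qed.

(** Each row of the left kernel of the basis matrix annihilates [S], hence is zero; the basis matrix
    then has a right inverse and its columns span everything. *)
Lemma subspace_full (F : fieldType) (n : nat) (S : 'cV[F]_n -> Prop) :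
  S 0 -> (forall a u v, S u -> S v -> S (a *: u + v)) ->
  (forall q : 'rV[F]_n, (forall v, S v -> q *m v = 0) -> q = 0) ->
  forall v, S v.
Proof.
move=> S0 Slin Sann v.
have [k [P [L [_ SP]]]] := subspace_basis S0 Slin.
have kP : kermx P = 0.
  apply/row_matrixP => i; rewrite row0; apply: Sann => u /SP[w ->].
  by rewrite mulmxA -row_mul mulmx_ker row0 mul0mx.
have /row_freeP[B PB] : row_free P by rewrite -kermx_eq0 kP.
by apply/SP; exists (B *m v); rewrite mulmxA PB mul1mx.
Qed.

Lemma subspace_factor (F : fieldType) (n k m : nat) (S : 'cV[F]_n -> Prop)
    (P : 'M[F]_(n, k)) (L : 'M[F]_(k, n)) :
  L *m P = 1%:M -> (forall v, S v <-> exists w, v = P *m w) ->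
  forall M : 'M[F]_(n, m), (forall j, S (col j M)) -> M = P *m (L *m M).
Proof.
move=> LP SP M SM; apply/matrixP => i c; have /SP[w cw] := SM c.
have /matrixP/(_ i 0) : col c M = col c (P *m (L *m M)).
  by rewrite !col_mulmx cw (mulmxA L) LP mul1mx.
by rewrite [LHS]mxE [RHS]mxE.
Qed.

(** [L *m invmx M *m P] is a left inverse of [N]. This passes both regressivity and the
    invertibility of [zI - A] to invariant subspaces. *)
Lemma unitmx_restrict (F : fieldType) (n k : nat) (M : 'M[F]_n) (N : 'M[F]_k)
    (P : 'M[F]_(n, k)) (L : 'M[F]_(k, n)) :
  L *m P = 1%:M -> M *m P = P *m N -> M \in unitmx -> N \in unitmx.
Proof.
move=> LP MP Mu.
have /mulmx1_unit[//] : (L *m invmx M *m P) *m N = 1%:M.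
by rewrite -mulmxA -MP mulmxA mulmxKV.
Qed.

(** * Polynomial numerators of transfer functions *)

Lemma size_adj_char_poly_mx (F : fieldType) (n : nat) (A : 'M[F]_n) i j :
  (size (\adj (char_poly_mx A) i j) <= n)%N.
Proof.
case: n A i j => [|n] A i j; first by case: i.
rewrite mxE /cofactor mulrC -(size_opp (_ * _)) -mulrN.
have [e ->] : exists e : F, - (-1) ^+ (j + i) = e%:P :> {poly F}.
  by exists (- (-1) ^+ (j + i)); rewrite rmorphN rmorphXn rmorphN1.
rewrite mulrC mul_polyC (leq_trans (size_scale_leq _ _)) //.
apply: leq_trans (size_sum _ _ _) _; apply/bigmax_leqP => s _.
rewrite mulr_sign; set p := \prod_(_ | _) _.
rewrite -[X in (X <= _)%N](_ : size p = _); last by case: ifP; rewrite ?size_opp.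
apply: leq_trans (size_poly_prod_leq _ _) _.
rewrite leq_subLR card_ord.
have : (\sum_(i0 : 'I_n) size (row' j (col' i (char_poly_mx A)) i0 (s i0)) <=
        \sum_(i0 : 'I_n) 2)%N.
  apply: leq_sum => l _; rewrite !mxE.
  rewrite (leq_trans (size_polyD _ _)) // geq_max size_opp.
  rewrite (leq_trans (size_polyC_leq1 _)) // andbT.
  by case: eqP; rewrite ?mulr1n ?size_polyX // mulr0n size_poly0.
rewrite sum_nat_const card_ord => h.
rewrite (leq_trans (_ : _ <= (n * 2).+1)%N) ?ltnS //.
by rewrite addnS muln2 addnn.
Qed.

(** The numerator of [C (zI - A)^-1 B] over the characteristic polynomial of [A]. *)
Definition resolvent_poly (F : fieldType) (n m p : nat) (A : 'M[F]_n)
    (B : 'M[F]_(n, m)) (C : 'M[F]_(p, n)) : 'M[{poly F}]_(p, m) :=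
  map_mx polyC C *m \adj (char_poly_mx A) *m map_mx polyC B.

Lemma size_resolvent_poly (F : fieldType) (n m p : nat) (A : 'M[F]_n)
    (B : 'M[F]_(n, m)) (C : 'M[F]_(p, n)) i j :
  (size (resolvent_poly A B C i j) <= n)%N.
Proof.
rewrite mxE (leq_trans (size_sum _ _ _)) //; apply/bigmax_leqP => k _.
rewrite mulrC [map_mx _ _ _ _]mxE mul_polyC (leq_trans (size_scale_leq _ _)) //.
rewrite mxE (leq_trans (size_sum _ _ _)) //; apply/bigmax_leqP => l _.
rewrite [map_mx _ _ _ _]mxE mul_polyC (leq_trans (size_scale_leq _ _)) //.
exact: size_adj_char_poly_mx.
Qed.

Lemma char_poly_mx_eval (F : fieldType) (n : nat) (A : 'M[F]_n) (z : F) :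
  map_mx (horner_eval z) (char_poly_mx A) = z%:M - A.
Proof.
apply/matrixP => i j; rewrite !mxE /horner_eval hornerD hornerN hornerC.
by rewrite hornerMn hornerX.
Qed.

Lemma resolvent_poly_eval (F : fieldType) (n m p : nat) (A : 'M[F]_n)
    (B : 'M[F]_(n, m)) (C : 'M[F]_(p, n)) (z : F) :
  map_mx (horner_eval z) (resolvent_poly A B C) = C *m \adj (z%:M - A) *m B.
Proof.
rewrite !map_mxM map_mx_adj char_poly_mx_eval.
by congr (_ *m _ *m _); apply/matrixP => i j; rewrite !mxE; exact: hornerC.
Qed.

(* From [X * adj (X - A) = A * adj (X - A) + char_poly A], comparing degrees. *)
Lemma resolvent_poly_eq0 (F : fieldType) (n m p : nat) (A : 'M[F]_n)
    (B : 'M[F]_(n, m)) (C : 'M[F]_(p, n)) (k : nat) :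
  resolvent_poly A B C = 0 -> C *m A ^+ k *m B = 0.
Proof.
move=> CB0.
suff : resolvent_poly A B (C *m A ^+ k) = 0 /\ C *m A ^+ k *m B = 0 by case.
have step (D : 'M[F]_(p, n)) : resolvent_poly A B D = 0 ->
    resolvent_poly A B (D *m A) = 0 /\ D *m B = 0.
  move=> DB0.
  have E : resolvent_poly A B (D *m A) =
      - (char_poly A *: map_mx polyC (D *m B)).
    have := mul_mx_adj (char_poly_mx A).
    rewrite {1}/char_poly_mx mulmxBl mul_scalar_mx -/(char_poly A) => /eqP.
    rewrite subr_eq addrC -subr_eq => /eqP E.
    rewrite /resolvent_poly map_mxM -(mulmxA (map_mx _ D)) -E mulmxBr mulmxBl.
    rewrite -scalemxAr -scalemxAl -/(resolvent_poly A B D) DB0 scaler0 sub0r.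
    by rewrite map_mxM mul_mx_scalar scalemxAl.
  have DB : D *m B = 0.
    apply/matrixP => i j; rewrite [RHS]mxE; apply/eqP; apply: contraT => nz.
    have := size_resolvent_poly A B (D *m A) i j.
    rewrite E mxE size_opp mxE [map_mx _ _ _ _]mxE mulrC mul_polyC.
    by rewrite size_scale // size_char_poly ltnn.
  by split=> //; rewrite E DB map_mx0 scaler0 oppr0.
elim: k => [|k [IH _]]; first by rewrite expr0 mulmx1; split; case: (step _ CB0).
have [h _] := step _ IH; rewrite exprSr mulmxA; split=> //.
by case: (step _ h).
Qed.

(** Multiplication by the product of the ['X - a%:P] over [s] yields a polynomial that vanishes
    everywhere, in particular at more natural numbers than its degree allows. *)
Lemma poly_cofinite_roots (F : numFieldType) (s : seq F) (p : {poly F}) :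
  (forall z, z \notin s -> p.[z] = 0) -> p = 0.
Proof.
move=> p0; pose q := p * \prod_(a <- s) ('X - a%:P).
suff : q == 0.
  by rewrite mulf_eq0 (negPf (monic_neq0 (monic_prod_XsubC _ _ _))) orbF => /eqP.
apply/eqP; apply: (@roots_geq_poly_eq0 _ q [seq i%:R | i <- iota 0 (size q)]).
- apply/allP => z _; rewrite /root hornerM; have [zs|/p0->] := boolP (z \in s).
    rewrite mulf_eq0; apply/orP; right.
    by rewrite -[_ == _]/(root _ z) root_prod_XsubC.
  by rewrite mul0r.
- by rewrite map_inj_uniq ?iota_uniq // => i j /eqP; rewrite eqr_nat => /eqP.
- by rewrite size_map size_iota.
Qed.

(** [X] stands for [(z - A)^-1 B]: by the adjugate identity [C adj(z - A) B = det(z - A) C X = 0]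
    off [s]. *)
Lemma markov_eq0 (F : numFieldType) (n m p : nat) (A : 'M[F]_n)
    (B : 'M[F]_(n, m)) (C : 'M[F]_(p, n)) (s : seq F) (k : nat) :
  (forall z, z \notin s -> exists X, (z%:M - A) *m X = B /\ C *m X = 0) ->
  C *m A ^+ k *m B = 0.
Proof.
move=> CX; apply: resolvent_poly_eq0; apply/matrixP => i j; rewrite [RHS]mxE.
apply: (@poly_cofinite_roots _ s) => z /CX[X [XB CX0]].
have /matrixP/(_ i j) := resolvent_poly_eval A B C z.
rewrite mxE /horner_eval => ->; rewrite -XB -mulmxA (mulmxA (\adj _)).
by rewrite mul_adj_mx mul_scalar_mx -scalemxAr CX0 scaler0 mxE.
Qed.

(** * Reachable and observable pairs *)

(** Kalman's rank condition on [[B, AB, A^2 B, ...]], in dual form. *)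
Definition reachable_pair (F : fieldType) (n m : nat) (A : 'M[F]_n)
    (B : 'M[F]_(n, m)) : Prop :=
  forall q : 'rV[F]_n, (forall k, q *m A ^+ k *m B = 0) -> q = 0.

Definition observable_pair (F : fieldType) (n p : nat) (A : 'M[F]_n)
    (C : 'M[F]_(p, n)) : Prop :=
  forall v : 'cV[F]_n, (forall k, C *m A ^+ k *m v = 0) -> v = 0.

Lemma trmxX (F : fieldType) (n k : nat) (A : 'M[F]_n) :
  (A ^+ k)^T = A^T ^+ k.
Proof. by elim: k => [|k IH]; rewrite ?trmx1 // exprS exprSr trmx_mul IH. Qed.

Lemma reachable_pair_tr (F : fieldType) (n p : nat) (A : 'M[F]_n)
    (C : 'M[F]_(p, n)) : reachable_pair A^T C^T <-> observable_pair A C.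
Proof.
split=> h v v0.
  apply: trmx_inj; rewrite trmx0; apply: h => k.
  by rewrite -trmxX -!trmx_mul mulmxA v0 trmx0.
apply: trmx_inj; rewrite trmx0; apply: h => k.
by apply: trmx_inj; rewrite !trmx_mul trmxK trmxX trmx0 mulmxA v0.
Qed.

(* The states [x'] of the second system that have the same output as [x] are
   defined for all [x] in the reachable space of the first. *)
Lemma markov_dim_le (F : fieldType) (n k m p : nat) (A : 'M[F]_n)
    (B : 'M[F]_(n, m)) (C : 'M[F]_(p, n)) (A' : 'M[F]_k)
    (B' : 'M[F]_(k, m)) (C' : 'M[F]_(p, k)) :
  reachable_pair A B -> observable_pair A C ->
  (forall i, C *m A ^+ i *m B = C' *m A' ^+ i *m B') -> (n <= k)%N.
Proof.
move=> rAB oAC mark.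
pose Z (x : 'cV[F]_n) (x' : 'cV[F]_k) :=
  forall i, C *m A ^+ i *m x = C' *m A' ^+ i *m x'.
have Zall x : exists x', Z x x'.
  move: x; apply: subspace_full.
  - by exists 0 => i; rewrite !mulmx0.
  - move=> a u v [u' Zu] [v' Zv]; exists (a *: u' + v') => i.
    by rewrite !mulmxDr -!scalemxAr Zu Zv.
  - move=> q q0; apply: rAB => j; apply/matrixP => r c.
    suff /q0 : exists x', Z (A ^+ j *m col c B) x'.
      by rewrite mulmxA -col_mulmx => /matrixP/(_ r 0); rewrite !mxE.
    exists (A' ^+ j *m col c B') => i.
    have powD l (M : 'M[F]_l) : M ^+ i *m M ^+ j = M ^+ (i + j).
      by rewrite exprD.
    by rewrite !mulmxA -(mulmxA C) -(mulmxA C') !powD -!col_mulmx mark.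
(* [Z] is only a relation; choosing partners for the basis vectors turns it into a linear map. *)
have [X' ZX'] : exists X' : 'M[F]_(k, n), forall x, Z x (X' *m x).
  have /choice[f Zf] := fun i : 'I_n => Zall (delta_mx i 0).
  exists (\matrix_(i, j) f j i 0) => x i.
  rewrite [x in LHS](_ : x = \sum_j x j 0 *: delta_mx j 0); last first.
    by apply/colP => l; rewrite {1}[x]matrix_sum_delta exchange_big big_ord1.
  rewrite (_ : _ *m x = \sum_j x j 0 *: f j); last first.
    apply/colP => l; rewrite !mxE summxE; apply: eq_bigr => j _.
    by rewrite !mxE mulrC.
  rewrite !mulmx_sumr; apply: eq_bigr => j _.
  by rewrite -!scalemxAr Zf.
suff : row_free X'^T by move/eqP <-; exact: rank_leq_col.
(* [X'] is injective: if [X' v = 0], then [C A^j v = C' A'^j X' v = 0] for all [j], and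
   observability gives [v = 0]. *)
rewrite -kermx_eq0; apply/eqP/row_matrixP => i; rewrite row0.
apply: trmx_inj; rewrite trmx0; apply: oAC => j.
rewrite ZX' (_ : X' *m _ = 0) ?mulmx0 //.
by apply: trmx_inj; rewrite trmx_mul trmxK -row_mul mulmx_ker row0 trmx0.
Qed.

(** The double annihilator [S] of the columns of all [A^k B] is the reachable subspace: invariant
    under [A], containing the columns of [B], and proper because of [q0]. *)
Lemma reachable_restriction (F : fieldType) (n m : nat) (A : 'M[F]_n)
    (B : 'M[F]_(n, m)) : ~ reachable_pair A B ->
  exists (k : nat) (P : 'M[F]_(n, k)) (L : 'M[F]_(k, n)) (A' : 'M[F]_k)
      (B' : 'M[F]_(k, m)),
    [/\ (k < n)%N, L *m P = 1%:M, A *m P = P *m A' & B = P *m B'].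
Proof.
move=> nr.
have [q0 [q0AB /eqP q0n0]] : exists q : 'rV[F]_n,
    (forall k, q *m A ^+ k *m B = 0) /\ q <> 0.
  by apply: contrapT => h; apply: nr => q qAB; apply: contrapT => q0; apply: h; exists q.
pose S (v : 'cV[F]_n) :=
  forall q : 'rV[F]_n, (forall k, q *m A ^+ k *m B = 0) -> q *m v = 0.
have S0 : S 0 by move=> q _; rewrite mulmx0.
have Slin a u v : S u -> S v -> S (a *: u + v).
  by move=> Su Sv q qAB; rewrite mulmxDr -scalemxAr Su // Sv // scaler0 addr0.
have [k [P [L [LP SP]]]] := subspace_basis S0 Slin.
have factor j := @subspace_factor _ _ _ j S P L LP SP.
exists k, P, L, (L *m (A *m P)), (L *m B); split=> //.
- rewrite ltn_neqAle; apply/andP; split; last first.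
    have : row_free P^T.
      by apply/row_freeP; exists L^T; rewrite -trmx_mul LP trmx1.
    by move/eqP <-; exact: rank_leq_col.
  (* In full dimension [L] would be a two-sided inverse of [P], and [q0 *m P = 0] would force
     [q0 = 0]. *)
  apply/eqP => kn; subst k; have PL := mulmx1C LP.
  case/eqP: q0n0; rewrite -[q0]mulmx1 -PL mulmxA.
  have -> : q0 *m P = 0; last by rewrite mul0mx.
  apply/rowP => c; rewrite [RHS]mxE.
  rewrite -[LHS](_ : (q0 *m col c P) 0 0 = _); last by rewrite -col_mulmx [LHS]mxE.
  suff /(_ _ q0AB) -> : S (col c P) by rewrite mxE.
  by apply/SP; exists (delta_mx c 0); rewrite colE.
- apply: factor => c q qAB; rewrite col_mulmx mulmxA.
  have : S (col c P) by apply/SP; exists (delta_mx c 0); rewrite colE.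
  apply=> i; rewrite -[q *m A *m _]mulmxA -[A *m _]/(A * _) -exprS; exact: qAB.
- apply: factor => c q qAB; rewrite -col_mulmx.
  by have := qAB 0%N; rewrite expr0 mulmx1 => ->; rewrite col0.
Qed.

(** The unobservable subspace is [A]-invariant and lies in the kernel of [C]. For the transposed
    pair, [P^T] extracts the coordinates of the state that no input can influence. *)
Lemma unobservable_basis (F : fieldType) (n p : nat) (A : 'M[F]_n)
    (C : 'M[F]_(p, n)) :
  exists (k : nat) (P : 'M[F]_(n, k)) (A' : 'M[F]_k),
    [/\ A *m P = P *m A', C *m P = 0 &
      forall v : 'cV[F]_n, (forall i, C *m A ^+ i *m v = 0) ->
        exists w, v = P *m w].
Proof.
pose S (v : 'cV[F]_n) := forall i, C *m A ^+ i *m v = 0.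
have S0 : S 0 by move=> i; rewrite mulmx0.
have Slin a u v : S u -> S v -> S (a *: u + v).
  by move=> Su Sv i; rewrite mulmxDr -scalemxAr Su Sv scaler0 addr0.
have [k [P [L [LP SP]]]] := subspace_basis S0 Slin.
have SPc j : S (col j P) by apply/SP; exists (delta_mx j 0); rewrite colE.
exists k, P, (L *m (A *m P)); split=> [||v /SP//].
  apply: (subspace_factor LP SP) => j i.
  rewrite col_mulmx mulmxA -(mulmxA C) -[_ *m A]/(_ * A) -exprSr; exact: SPc.
apply/matrixP => i j; have /matrixP/(_ i 0) := SPc j 0%N.
by rewrite expr0 mulmx1 -col_mulmx [LHS]mxE [RHS]mxE => ->; rewrite mxE.
Qed.

(** By Cayley-Hamilton, [A ^+ i] is the value at [A] of the remainder of ['X^i] modulo the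
    characteristic polynomial, which has degree less than [n]. *)
Lemma mxpow_lt_dim (F : fieldType) (n m p : nat) (A : 'M[F]_n)
    (B : 'M[F]_(n, m)) (C : 'M[F]_(p, n)) :
  (forall i, (i < n)%N -> C *m A ^+ i *m B = 0) ->
  forall i, C *m A ^+ i *m B = 0.
Proof.
case: n A B C => [|n] A B C CB i; first by rewrite [B]flatmx0 mulmx0.
have small (q : {poly F}) : (size q <= n.+1)%N -> C *m horner_mx A q *m B = 0.
  move=> qn; rewrite -[q]coefK poly_def rmorph_sum /= mulmx_sumr mulmx_suml.
  apply: big1 => j _; rewrite -mul_polyC rmorphM /= rmorphXn /= horner_mx_C.
  rewrite horner_mx_X -[_ * _]/(_ *m _) mul_scalar_mx.
  by rewrite -scalemxAr -scalemxAl CB ?scaler0 // (leq_trans (ltn_ord j)).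
have -> : A ^+ i = horner_mx A ('X^i %% char_poly A).
  rewrite -[in LHS](horner_mx_X A) -rmorphXn /= {1}(divp_eq 'X^i (char_poly A)).
  by rewrite rmorphD rmorphM /= Cayley_Hamilton mulr0 add0r.
apply: small; rewrite -ltnS -(size_char_poly A) ltn_modp.
by rewrite monic_neq0 // char_poly_monic.
Qed.

(** * Restricting, transposing and comparing realizations *)

Lemma regressive_restrict (R : realType) (T : set R) (n k : nat)
    (A : 'M[R]_n) (A' : 'M[R]_k) (P : 'M[R]_(n, k)) (L : 'M[R]_(k, n)) :
  L *m P = 1%:M -> A *m P = P *m A' -> regressive T A -> regressive T A'.
Proof.
move=> LP AP rA t Tt; apply: unitmx_restrict LP _ (rA t Tt).
by rewrite mulmxDl mulmxDr mul1mx mulmx1 -scalemxAl -scalemxAr AP.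
Qed.

(** [(zI - A) P = P (zI - A')] gives [(zI - A)^-1 P = P (zI - A')^-1], and [B] factors through
    [P]. *)
Lemma realization_restrict (R : realType) (n k m p : nat)
    (A : 'M[R]_n) (B : 'M[R]_(n, m)) (C : 'M[R]_(p, n)) G
    (A' : 'M[R]_k) (B' : 'M[R]_(k, m)) (P : 'M[R]_(n, k)) (L : 'M[R]_(k, n)) :
  L *m P = 1%:M -> A *m P = P *m A' -> B = P *m B' ->
  realization A B C G -> realization A' B' (C *m P) G.
Proof.
move=> LP AP BP [s sG]; exists s => z /sG /= [zA <-].
set f := real_complex R in zA *.
have LPf : map_mx f L *m map_mx f P = 1%:M by rewrite -map_mxM LP map_mx1.
have APf : (z%:M - map_mx f A) *m map_mx f P = map_mx f P *m (z%:M - map_mx f A').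
  by rewrite mulmxBl mulmxBr -!map_mxM AP -scalar_mxC.
have zA' := unitmx_restrict LPf APf zA; split=> //.
rewrite BP !map_mxM -!mulmxA; congr (_ *m _); rewrite !mulmxA; congr (_ *m _).
by rewrite -[LHS](mulKmx zA) (mulmxA _ (map_mx f P)) APf mulmxK.
Qed.

Lemma realization_tr (R : realType) (n m p : nat) (A : 'M[R]_n)
    (B : 'M[R]_(n, m)) (C : 'M[R]_(p, n)) G :
  realization A B C G -> realization A^T C^T B^T (fun z => (G z)^T).
Proof.
move=> [s sG]; exists s => z /sG /= [zA <-].
have E : z%:M - map_mx (real_complex R) A^T = (z%:M - map_mx (real_complex R) A)^T.
  by rewrite linearB /= tr_scalar_mx map_trmx.
by rewrite E unitmx_tr; split=> //; rewrite !trmx_mul trmx_inv !map_trmx mulmxA.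
Qed.

Lemma regressive_tr (R : realType) (T : set R) (n : nat) (A : 'M[R]_n) :
  regressive T A -> regressive T A^T.
Proof.
move=> rA t Tt; rewrite -unitmx_tr linearD linearZ /= trmxK trmx1; exact: rA.
Qed.

(** The block-diagonal system with output [C x - C' x'] has transfer function [G - G = 0] off
    [s ++ s'], so its Markov parameters vanish; the result descends from complex to real entries by
    injectivity of the embedding. *)
Lemma realization_markov (R : realType) (n k m p : nat) (A : 'M[R]_n)
    (B : 'M[R]_(n, m)) (C : 'M[R]_(p, n)) (A' : 'M[R]_k)
    (B' : 'M[R]_(k, m)) (C' : 'M[R]_(p, k)) G i :
  realization A B C G -> realization A' B' C' G ->
  C *m A ^+ i *m B = C' *m A' ^+ i *m B'.
Proof.
move=> [s sG] [s' sG'].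
have pw : block_mx A 0 0 A' ^+ i = block_mx (A ^+ i) 0 0 (A' ^+ i).
  elim: i => [|i IH]; first by rewrite !expr0 -scalar_mx_block.
  by rewrite !exprS IH -[LHS]/(_ *m _) mulmx_block !(mul0mx, mulmx0, addr0, add0r).
set f := real_complex R in sG sG'.
have : map_mx f (row_mx C (- C')) *m map_mx f (block_mx A 0 0 A') ^+ i
         *m map_mx f (col_mx B B') = 0.
  apply: (@markov_eq0 _ _ _ _ _ _ _ (s ++ s')) => z; rewrite mem_cat negb_or.
  move=> /andP[/sG /= [zA GA] /sG' /= [zA' GA']].
  exists (col_mx (invmx (z%:M - map_mx f A) *m map_mx f B)
                 (invmx (z%:M - map_mx f A') *m map_mx f B')).
  rewrite map_block_mx map_col_mx map_row_mx !map_mx0 scalar_mx_block.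
  rewrite opp_block_mx add_block_mx !oppr0 !addr0 mul_block_col !mul0mx.
  rewrite addr0 add0r !mulKVmx //; split=> //.
  by rewrite mul_row_col map_mxN mulNmx !mulmxA GA GA' subrr.
have -> l (M : 'M[R]_l) : map_mx f M ^+ i = map_mx f (M ^+ i).
  elim: (i) => [|j IH]; first by rewrite !expr0 [RHS]map_mx1.
  by rewrite !exprS IH; apply/esym/map_mxM.
rewrite -!map_mxM pw mul_row_block !mulmx0 addr0 add0r mul_row_col.
rewrite !mulNmx => E.
apply/eqP; rewrite -subr_eq0; apply/eqP/matrixP => a b.
have /matrixP/(_ a b) := E; rewrite [LHS]mxE [RHS]mxE => /eqP.
by rewrite fmorph_eq0 => /eqP ->; rewrite mxE.
Qed.

(** * Delta derivatives *)

Lemma mx_entry_norm (R : realType) (m n : nat) (M : 'M[R]_(m, n)) i j :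
  `|M i j| <= `|M|.
Proof.
by rewrite [leRHS]/Num.Def.normr /= mx_normrE; apply/bigmax_geP; right; exists (i, j).
Qed.

Lemma mx_norm_le (R : realType) (m n : nat) (M : 'M[R]_(m, n)) (c : R) :
  0 <= c -> (forall i j, `|M i j| <= c) -> `|M| <= c.
Proof.
by move=> c0 Mc; rewrite [leLHS]/Num.Def.normr /= mx_normrE; apply/bigmax_leP.
Qed.

Lemma mulmx_norm (R : realType) (m n p : nat) (M : 'M[R]_(m, n))
    (N : 'M[R]_(n, p)) : `|M *m N| <= n%:R * `|M| * `|N|.
Proof.
apply: mx_norm_le => [|i j]; first by rewrite !mulr_ge0.
rewrite mxE (le_trans (ler_norm_sum _ _ _)) //.
rewrite -mulrA mulr_natl -[X in _ *+ X]card_ord -sumr_const ler_sum // => k _.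
by rewrite normrM ler_pM // mx_entry_norm.
Qed.

Lemma near_withinP (R : realType) (X : set R) (t : R) (P : R -> Prop) :
  (\forall s \near within X (nbhs t), P s) <->
  exists2 d : R, 0 < d & forall s, X s -> `|s - t| < d -> P s.
Proof.
rewrite near_withinE; split.
  move=> /nbhs_ballP[d /= d0 dP]; exists d => // s Xs std; apply: dP => //.
  by rewrite /ball /= distrC.
move=> [d d0 dP]; apply/nbhs_ballP; exists d => //= s; rewrite /ball /= distrC.
by move=> std Xs; exact: dP.
Qed.

(** * The forward jump and induction on a time scale *)

(** The properties of [from_time T 0] on which the analysis rests. The last one keeps [fwd_jump]
    from being the infimum of an empty set. *)
Definition half_line (R : realType) (X : set R) : Prop :=
  [/\ closed X, X 0, forall t, X t -> 0 <= t & forall r, exists2 s, X s & r < s].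

Section ForwardJump.
Variables (R : realType) (X : set R).
Hypothesis hX : half_line X.
Implicit Types t s : R.

Let later_inf t : has_inf [set s | X s /\ t < s].
Proof.
have [_ _ _ /(_ t)[s Xs ts]] := hX.
by split; [exists s | exists t => r [_ /ltW]].
Qed.

Lemma fwd_jump_ge t : t <= fwd_jump X t.
Proof. by apply: lb_le_inf; [case: (later_inf t) | move=> r [_ /ltW]]. Qed.

Lemma fwd_jump_le t s : X s -> t < s -> fwd_jump X t <= s.
Proof. by move=> Xs ts; apply: ge_inf => //; case: (later_inf t). Qed.

Lemma fwd_jump_near t d : 0 < d ->
  exists s, [/\ X s, t < s & s < fwd_jump X t + d].
Proof.
by move=> d0; have [s [Xs ts] sd] := inf_adherent d0 (later_inf t); exists s.
Qed.

Lemma fwd_jump_in t : X (fwd_jump X t).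
Proof.
have [cX _ _ _] := hX; apply: cX => B /nbhs_ballP[d /= d0 dB].
have [s [Xs ts sd]] := fwd_jump_near t d0.
exists s; split=> //; apply: dB; rewrite /ball /= ltr_norml.
have := fwd_jump_le Xs ts; lra.
Qed.

Lemma half_line_sup (G : set R) : G !=set0 -> has_ubound G -> G `<=` X ->
  X (sup G).
Proof.
move=> G0 Gb GX; have [cX _ _ _] := hX; apply: cX => B /(closure_sup G0 Gb).
by move=> [s [/GX Xs Bs]]; exists s.
Qed.

(** Real induction. If [P] failed at [t], the times up to which [P] holds would be bounded by [t];
    [P] holds at their supremum and can be pushed past it. The last clause admits [s = t], so it is
    trivially true at a point that is not a limit from the left. *)
Lemma half_line_ind (P : R -> Prop) : P 0 ->
  (forall t, X t -> P t -> P (fwd_jump X t)) ->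
  (forall t, X t -> P t -> fwd_jump X t = t ->
     exists2 d, 0 < d & forall s, X s -> t < s -> s < t + d -> P s) ->
  (forall t, X t ->
     (forall d, 0 < d -> exists s, [/\ X s, t - d < s, s <= t & P s]) -> P t) ->
  forall t, X t -> P t.
Proof.
move=> P0 Pjump Pdense Plim t Xt; apply: contrapT => nPt.
pose G := [set s | X s /\ forall r, X r -> r <= s -> P r].
have [_ X0 Xpos _] := hX.
have G0 : G 0.
  split=> // r Xr r0; suff -> : r = 0 by [].
  by apply/eqP; rewrite eq_le r0 Xpos.
have Gt s : G s -> s < t.
  by move=> [Xs sP]; rewrite ltNge; apply/negP => /(sP _ Xt).
have Gb : has_ubound G by exists t => s /Gt/ltW.
have Gn : G !=set0 by exists 0.
have XG : X (sup G) by apply: half_line_sup => // s [].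
set u := sup G in XG.
have Gle s : G s -> s <= u by move=> Gs; exact: ub_le_sup.
have Gadh d : 0 < d -> exists s, G s /\ u - d < s.
  by move=> d0; have [s Gs us] := sup_adherent d0 (conj Gn Gb); exists s.
have Plt r : X r -> r < u -> P r.
  move=> Xr ru; have [|s [[_ sP] us]] := Gadh (u - r); first by rewrite subr_gt0.
  by apply: sP => //; lra.
have Pu : P u.
  apply: Plim => // d d0; have [s [Gs us]] := Gadh d d0.
  by exists s; split; [case: Gs | | exact: Gle | case: Gs => Xs; apply].
have Ple r : X r -> r <= u -> P r.
  by move=> Xr; rewrite le_eqVlt => /predU1P[->//|]; exact: Plt.
(* Right-dense or right-scattered, a point of [G] beyond its supremum [u] is produced. *)
have [ju|uj] := eqVneq (fwd_jump X u) u.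
  have [d d0 dP] := Pdense _ XG Pu ju.
  have [s [Xs us sd]] := fwd_jump_near u d0; rewrite ju in sd.
  suff /Gle : G s by rewrite leNgt us.
  split=> // r Xr rs; have [/Ple|ur] := leP r u; first exact.
  by apply: dP => //; exact: le_lt_trans sd.
have ltj : u < fwd_jump X u by rewrite lt_neqAle eq_sym uj fwd_jump_ge.
suff /Gle : G (fwd_jump X u) by rewrite leNgt ltj.
split=> [|r Xr rj]; first exact: fwd_jump_in.
have [/Ple|ur] := leP r u; first exact.
suff -> : r = fwd_jump X u by exact: Pjump.
by apply/eqP; rewrite eq_le rj fwd_jump_le.
Qed.

End ForwardJump.

(** * Calculus of delta derivatives *)

Section DeltaDerivative.
Variables (R : realType) (X : set R).
Implicit Types t : R.

Lemma delta_derivativeP (V : normedModType R) (f : R -> V) t (L : V) :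
  delta_derivative X f t L <->
  forall e : R, 0 < e -> exists2 d : R, 0 < d &
    forall s, X s -> `|s - t| < d ->
      `|f (fwd_jump X t) - f s - (fwd_jump X t - s) *: L|
        <= e * `|fwd_jump X t - s|.
Proof.
by split=> h e e0; have := h e e0; [move/near_withinP | move=> ?; apply/near_withinP].
Qed.

Lemma delta_derivative_bounded (V W : normedModType R) (g : {linear V -> W})
    (c : R) (f : R -> V) t (L : V) :
  (forall v, `|g v| <= c * `|v|) -> delta_derivative X f t L ->
  delta_derivative X (g \o f) t (g L).
Proof.
move=> gc /delta_derivativeP fL; apply/delta_derivativeP => e e0.
have c0 : 0 < `|c| + 1 by rewrite ltr_wpDl.
have [d d0 dP] := fL (e / (`|c| + 1)) (divr_gt0 e0 c0).
exists d => // s Xs std; rewrite /= -linearB -linearZ -linearB.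
apply: le_trans (gc _) _; have := dP s Xs std.
rewrite mulrAC ler_pdivlMr // mulrC; apply: le_trans; rewrite ler_wpM2r //.
by rewrite (le_trans (ler_norm c)) // lerDl.
Qed.

Lemma delta_derivativeD (V : normedModType R) (f g : R -> V) t (L M : V) :
  delta_derivative X f t L -> delta_derivative X g t M ->
  delta_derivative X (fun s => f s + g s) t (L + M).
Proof.
move=> /delta_derivativeP fL /delta_derivativeP gM; apply/delta_derivativeP => e e0.
have e2 : 0 < e / 2 by rewrite divr_gt0.
have [d d0 dP] := fL _ e2; have [d' d'0 d'P] := gM _ e2.
exists (Order.min d d') => [|s Xs]; first by rewrite lt_min d0.
rewrite lt_min => /andP[sd sd'].
rewrite [X in X * _](splitr e) mulrDl.
apply: le_trans (lerD (dP _ Xs sd) (d'P _ Xs sd')).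
rewrite scalerDr !opprD (addrACA (f _)) (addrACA (f _ - f _)); exact: ler_normD.
Qed.

Lemma delta_derivative_dist (V : normedModType R) (f : R -> V) t (L : V) :
  X t -> delta_derivative X f t L -> forall e, 0 < e ->
  exists2 d, 0 < d & forall s, X s -> `|s - t| < d -> `|f t - f s| <= e.
Proof.
move=> Xt /delta_derivativeP fL e e0; set j := fwd_jump X t in fL.
(* For [|s - t| < 1] the two remainders, at [s] and at [t], have weights
   [|j - s| + |j - t| <= k / 2], so tolerance [e / k] costs [e / 2]; the linear term costs the other
   half through [l]. *)
set k := 2 * (2 * `|j - t| + 1); have k0 : 0 < k by rewrite mulr_gt0 // ltr_wpDl // mulr_ge0.
have [d d0 dP] := fL (e / k) (divr_gt0 e0 k0).
set l := 2 * (`|L| + 1); have l0 : 0 < l by rewrite mulr_gt0 // ltr_wpDl.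
exists (Order.min d (Order.min 1 (e / l))) => [|s Xs].
  by rewrite !lt_min d0 ltr01 divr_gt0.
rewrite !lt_min => /and3P[sd s1 sl].
have -> : f t - f s = (f j - f s - (j - s) *: L) - (f j - f t - (j - t) *: L)
    + (t - s) *: L.
  have -> : t - s = (j - s) - (j - t) by ring.
  set u := (j - s) *: L; set v := (j - t) *: L; rewrite scalerBl -/u -/v.
  by rewrite opprD (addrACA _ (- u)) -(opprD u) subrK opprB addrC subrKA.
rewrite (le_trans (ler_normD _ _)) // [leRHS]splitr lerD //.
  rewrite (le_trans (ler_normB _ _)) //.
  rewrite (le_trans (lerD (dP _ Xs sd) (dP _ Xt _))) ?subrr ?normr0 //.
  rewrite -mulrDr mulrAC ler_pdivrMr // (_ : e / 2 * k = e * (2 * `|j - t| + 1)).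
    have := ler_distD t j s; rewrite (distrC t s) => jts.
    by rewrite ler_pM2l //; lra.
  by rewrite /k; field.
rewrite normrZ distrC (@le_trans _ _ (e / l * (`|L| + 1))) //.
  by apply: ler_pM => //; [exact: ltW | rewrite lerDl].
have : `|L| + 1 != 0 by rewrite lt0r_neq0 // ltr_wpDl.
by move=> L0; rewrite /l (_ : _ * _ = e / 2) //; field.
Qed.

End DeltaDerivative.

Lemma le0_eps (R : realType) (x : R) : (forall e, 0 < e -> x <= e) -> x <= 0.
Proof.
by move=> xe; apply/ler_addgt0Pr => e e0; rewrite -[leRHS]/(0 + e) add0r; exact: xe.
Qed.

Section DeltaDerivativeMatrix.
Variables (R : realType) (X : set R).
Implicit Types t : R.

Lemma delta_derivative_mulmxl (m n p : nat) (D : 'M[R]_(m, n))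
    (f : R -> 'M[R]_(n, p)) t (L : 'M[R]_(n, p)) :
  delta_derivative X f t L ->
  delta_derivative X (fun s => D *m f s) t (D *m L).
Proof. exact: (delta_derivative_bounded (mulmx_norm D)). Qed.

Lemma delta_derivative_mulmxr (m n p : nat) (D : 'M[R]_(n, p))
    (f : R -> 'M[R]_(m, n)) t (L : 'M[R]_(m, n)) :
  delta_derivative X f t L ->
  delta_derivative X (fun s => f s *m D) t (L *m D).
Proof.
apply: (@delta_derivative_bounded _ _ _ _ (mulmxr D) (n%:R * `|D|)) => v /=.
by rewrite mulrAC mulmx_norm.
Qed.

Lemma delta_derivativeZ (V : normedModType R) (a : R) (f : R -> V) t (L : V) :
  delta_derivative X f t L -> delta_derivative X (fun s => a *: f s) t (a *: L).
Proof.
by apply: (@delta_derivative_bounded _ _ _ _ ( *:%R a) `|a|) => v; rewrite normrZ.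
Qed.

(** The definition may be evaluated at [s = t] itself, where the error is then below every positive
    bound. *)
Lemma delta_derivative_jump (V : normedModType R) (f : R -> V) t (L : V) :
  X t -> delta_derivative X f t L ->
  f (fwd_jump X t) = f t + (fwd_jump X t - t) *: L.
Proof.
move=> Xt /delta_derivativeP fL; set j := fwd_jump X t in fL *.
apply/eqP; rewrite -subr_eq0 opprD addrA -normr_le0.
apply: le0_eps => e e0.
have k0 : 0 < `|j - t| + 1 by rewrite ltr_wpDl.
have [d d0 dP] := fL (e / (`|j - t| + 1)) (divr_gt0 e0 k0).
apply: le_trans (dP t Xt _) _; first by rewrite subrr normr0.
by rewrite mulrAC ler_pdivrMr // ler_pM2l // lerDl.
Qed.

End DeltaDerivativeMatrix.

(** Uniqueness by a Gronwall bound: induction along [X] gives [|w s| <= e * expR (l * s)] for every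
    [e > 0]. In [l = c + 1], [c] accounts for [A] and 1 for the differentiation error. *)
Lemma delta_homogeneous_eq0 (R : realType) (X : set R) (n k : nat)
    (A : 'M[R]_n) (w : R -> 'M[R]_(n, k)) : half_line X ->
  (forall t, X t -> delta_derivative X w t (A *m w t)) -> w 0 = 0 ->
  forall t, X t -> w t = 0.
Proof.
move=> hX wA w0 t Xt; set c := n%:R * `|A|; set l := c + 1.
have c0 : 0 <= c by rewrite mulr_ge0.
have Aw s : `|A *m w s| <= c * `|w s| by exact: mulmx_norm.
have bound e : 0 < e -> forall s, X s -> `|w s| <= e * expR (l * s).
  move=> e0; apply: (half_line_ind hX).
  - by rewrite w0 normr0 mulr_ge0 ?ltW // expR_gt0.
  - move=> s Xs; set b := e * _ => ws.
    rewrite (delta_derivative_jump Xs (wA _ Xs)).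
    have sj := fwd_jump_ge hX s; set j := fwd_jump X s in sj *.
    have -> : e * expR (l * j) = b * expR (l * (j - s)).
      by rewrite /b -mulrA -expRD; congr (_ * expR _); ring.
    have b0 : 0 <= b by exact: le_trans ws.
    apply: le_trans (ler_normD _ _) _; rewrite normrZ ger0_norm ?subr_ge0 //.
    have h1 : 1 + l * (j - s) <= expR (l * (j - s)) := expR_ge1Dx _.
    apply: le_trans (ler_wpM2l b0 h1).
    have h2 := ler_wpM2l (_ : 0 <= j - s) (Aw s).
    rewrite subr_ge0 in h2; have {h2} := h2 sj.
    have h3 : c * `|w s| <= c * b by rewrite ler_wpM2l.
    have h4 := ler_wpM2l (_ : 0 <= j - s) h3.
    rewrite subr_ge0 in h4; have {h4} := h4 sj.
    have : 0 <= b * (j - s) by rewrite mulr_ge0 // subr_ge0.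
    by rewrite /l; lra.
  - move=> s Xs; set b := e * expR (l * s) => ws js.
    have b0 : 0 < b by rewrite mulr_gt0 // expR_gt0.
    (* The current bound [b] serves as the tolerance, so the error [b * (r - s)] is what the extra 1
       in [l] absorbs. *)
    have /delta_derivativeP/(_ b b0)[d d0 dP] := wA _ Xs.
    exists d => // r Xr sr rd; rewrite js in dP.
    have -> : e * expR (l * r) = b * expR (l * (r - s)).
      by rewrite /b -mulrA -expRD; congr (_ * expR _); ring.
    have h1 : 1 + l * (r - s) <= expR (l * (r - s)) := expR_ge1Dx _.
    apply: le_trans (ler_wpM2l (ltW b0) h1).
    have rs0 : 0 <= r - s by rewrite subr_ge0 ltW.
    have := dP _ Xr; rewrite (distrC s) ger0_norm // => /(_ _) h2.
    have {h2} : `|w s - w r - (s - r) *: (A *m w s)| <= b * (r - s).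
      by apply: h2; lra.
    move=> h2; have -> : w r = w s + (r - s) *: (A *m w s)
        - (w s - w r - (s - r) *: (A *m w s)).
      rewrite -(opprB r s) scaleNr opprK; set u := _ *: _.
      by rewrite opprD opprB addrACA subrr addr0 addrC subrK.
    apply: le_trans (ler_normB _ _) _.
    have h3 : `|w s + (r - s) *: (A *m w s)| <= b + (r - s) * (c * b).
      apply: le_trans (ler_normD _ _) _; rewrite normrZ ger0_norm //.
      by rewrite lerD // ler_wpM2l // (le_trans (Aw s)) // ler_wpM2l.
    by apply: le_trans (lerD h3 h2) _; rewrite /l; lra.
  - move=> s Xs sP; rewrite -subr_le0; apply: le0_eps => h h0.
    have [d d0 dP] := delta_derivative_dist Xs (wA _ Xs) h0.
    have [r [Xr dr rs wr]] := sP d d0.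
    have : `|w s - w r| <= h by apply: dP => //; rewrite ltr_norml; lra.
    have : expR (l * r) <= expR (l * s).
      by rewrite ler_expR ler_wpM2l // addr_ge0.
    move=> /(ler_wpM2l (ltW e0)).
    have := lerB_dist (w s) (w r); lra.
apply/eqP; rewrite -normr_le0; apply: le0_eps => e e0.
have E0 := expR_gt0 (l * t).
by have := bound (e / expR (l * t)) (divr_gt0 e0 E0) t Xt; rewrite mulfVK // lt0r_neq0.
Qed.

(** The assumed estimate takes the slope at the earlier of two points. For [s < t] the slope at [s]
    is exchanged for that at [t], which costs another quadratic term since [x] is locally
    Lipschitz. *)
Lemma delta_derivative_quadratic (R : realType) (X : set R) (n k : nat)
    (A : 'M[R]_n) (x : R -> 'M[R]_(n, k)) (t C d : R) :
  half_line X -> X t -> 0 < d ->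
  x (fwd_jump X t) = x t + (fwd_jump X t - t) *: (A *m x t) ->
  (forall a, X a -> `|a - t| < d -> `|x a| <= C) ->
  (forall a b, X a -> X b -> `|a - t| < d -> `|b - t| < d -> a <= b ->
    `|x b - x a - (b - a) *: (A *m x a)| <= C * (b - a) ^+ 2) ->
  delta_derivative X x t (A *m x t).
Proof.
move=> hX Xt d0 xj xC xE; apply/delta_derivativeP => e e0.
have C0 : 0 <= C by apply: le_trans (xC _ Xt _); rewrite ?subrr ?normr0.
set c := n%:R * `|A|; have c0 : 0 <= c by rewrite mulr_ge0.
set K := C + c * (C + c * C); have K0 : 0 <= K by rewrite !(addr_ge0, mulr_ge0).
have key s : X s -> `|s - t| < d -> `|s - t| < 1 ->
    `|x t - x s - (t - s) *: (A *m x t)| <= K * (t - s) ^+ 2.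
  have CK : C <= K by rewrite lerDl !(addr_ge0, mulr_ge0).
  move=> Xs sd s1; have tt : `|t - t| < d by rewrite subrr normr0.
  have [ts|/ltW st] := leP t s.
    have -> : x t - x s - (t - s) *: (A *m x t) =
        - (x s - x t - (s - t) *: (A *m x t)).
      by rewrite -(opprB s t) scaleNr opprK !opprB addrC.
    rewrite normrN (le_trans (xE _ _ Xt Xs tt sd ts)) // -(opprB s t) sqrrN.
    by rewrite ler_wpM2r // sqr_ge0.
  have h := xE _ _ Xs Xt sd tt st.
  have ts0 : 0 <= t - s by rewrite subr_ge0.
  have h2 : `|x t - x s| <= (t - s) * (C + c * C).
    rewrite -(subrK ((t - s) *: (A *m x s)) (x t - x s)).
    apply: le_trans (ler_normD _ _) _; rewrite mulrDr lerD //.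
      apply: le_trans h _; rewrite mulrC ler_wpM2r // expr2 ler_piMr //.
      by move: s1; rewrite distrC ger0_norm // => /ltW.
    rewrite normrZ ger0_norm // ler_wpM2l // (le_trans (mulmx_norm _ _)) //.
    by rewrite -/c ler_wpM2l // xC.
  have -> : x t - x s - (t - s) *: (A *m x t) =
      (x t - x s - (t - s) *: (A *m x s)) - (t - s) *: (A *m (x t - x s)).
    by rewrite mulmxBr scalerBr opprB addrA subrK.
  apply: le_trans (ler_normB _ _) _; rewrite mulrDl lerD //.
  rewrite normrZ ger0_norm // expr2 mulrA [leLHS]mulrC ler_wpM2r //.
  rewrite (_ : c * _ * _ = c * ((t - s) * (C + c * C))); last by ring.
  by apply: le_trans (mulmx_norm _ _) _; exact: ler_wpM2l.
pose j := fwd_jump X t; have tj := fwd_jump_ge hX t; rewrite -/j in xj tj *.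
(* If [t] is right-scattered, points closer to [t] than [j - t] cannot lie after [t]; hence
   [|t - s| <= |j - s|]. If [j = t] this is an equality and the value 1 is arbitrary. *)
pose g := if j == t then 1 else j - t.
have g0 : 0 < g.
  by rewrite /g; case: eqVneq => // jt; rewrite subr_gt0 lt_neqAle eq_sym jt.
have eK : 0 < e / (K + 1) by rewrite divr_gt0 // ltr_wpDl.
exists (Order.min (Order.min d 1) (Order.min g (e / (K + 1)))) => [|s Xs].
  by rewrite !lt_min d0 ltr01 g0.
rewrite !lt_min => /andP[/andP[sd s1] /andP[sg se]].
have ts : `|t - s| <= `|j - s|.
  move: sg; rewrite /g; case: eqVneq => [->//|jt sg].
  have sj : s < j by move: sg; rewrite ltr_norml; lra.
  have st : s <= t by rewrite leNgt; apply/negP => /(fwd_jump_le hX Xs); rewrite -/j leNgt sj.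
  by rewrite !ger0_norm; lra.
have -> : x j - x s - (j - s) *: (A *m x t) = x t - x s - (t - s) *: (A *m x t).
  rewrite xj (_ : j - s = (j - t) + (t - s)); last by rewrite subrKA.
  by rewrite (scalerDl _ (j - t)) opprD addrA (addrAC (x t)) addrK.
apply: le_trans (key s Xs sd s1) _; rewrite -real_normK ?num_real // expr2 mulrA.
apply: ler_pM => //; first by rewrite mulr_ge0.
move: se; rewrite distrC ltr_pdivlMr ?ltr_wpDl // => /ltW; apply: le_trans.
by rewrite mulrC ler_wpM2l // lerDl.
Qed.

(** * The fundamental matrix *)

Definition lemx (R : realType) (m n : nat) (M N : 'M[R]_(m, n)) : Prop :=
  forall i j, M i j <= N i j.

Local Notation "M <=mx N" := (lemx M N) (at level 70).

Section EntrywiseOrder.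
Variable R : realType.

Lemma lemx_refl (m n : nat) (M : 'M[R]_(m, n)) : M <=mx M.
Proof. by []. Qed.

Lemma lemx_trans (m n : nat) (M N P : 'M[R]_(m, n)) :
  M <=mx N -> N <=mx P -> M <=mx P.
Proof. by move=> MN NP i j; exact: le_trans (NP i j). Qed.

Lemma lemxD (m n : nat) (M N P Q : 'M[R]_(m, n)) :
  M <=mx N -> P <=mx Q -> M + P <=mx N + Q.
Proof. by move=> MN PQ i j; rewrite !mxE lerD. Qed.

Lemma lemxZ (m n : nat) (a : R) (M N : 'M[R]_(m, n)) :
  0 <= a -> M <=mx N -> a *: M <=mx a *: N.
Proof. by move=> a0 MN i j; rewrite !mxE ler_wpM2l. Qed.

Lemma lemxM (m n p : nat) (M : 'M[R]_(m, n)) (N P : 'M[R]_(n, p)) :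
  0 <=mx M -> N <=mx P -> M *m N <=mx M *m P.
Proof.
move=> M0 NP i j; rewrite !mxE ler_sum // => k _.
by rewrite ler_wpM2l //; have := M0 i k; rewrite mxE.
Qed.

Lemma lemx_norm (m n : nat) (M N : 'M[R]_(m, n)) :
  0 <=mx M -> M <=mx N -> `|M| <= `|N|.
Proof.
move=> M0 MN; apply: mx_norm_le => // i j; have := M0 i j; rewrite mxE => Mij.
rewrite ger0_norm // (le_trans (MN i j)) //.
by rewrite (le_trans (ler_norm _)) // mx_entry_norm.
Qed.

End EntrywiseOrder.

Definition exp_remainder (R : realType) (x : R) : R := expR x - 1 - x.

Lemma exp_remainder_ge0 (R : realType) (x : R) : 0 <= exp_remainder x.
Proof. by have := expR_ge1Dx x; rewrite /exp_remainder; lra. Qed.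

(** After multiplication by [1 - x > 0], the inequality [expR x * (1 - x) <= 1] leaves
    [x^2 (1 - 2x) >= 0]. *)
Lemma exp_remainder_le (R : realType) (x : R) : 0 <= x -> x <= 1 / 2 ->
  exp_remainder x <= 2 * x ^+ 2.
Proof.
move=> x0 x1; have := expR_ge1Dx (- x).
move=> /(ler_wpM2l (expR_ge0 x)); rewrite -expRD subrr expR0 => h.
have y0 : 0 < 1 - x by lra.
rewrite -(ler_pM2r y0) /exp_remainder.
have : 0 <= x ^+ 2 * (1 - 2 * x) by rewrite mulr_ge0 ?sqr_ge0 //; lra.
by rewrite expr2; lra.
Qed.

(** The remainder at [l s] dominates Euler steps of [y' = l y + s]; besides convexity of the
    exponential, the slack is [(l^2 - 1) a (b - a)]. *)
Lemma exp_remainder_step (R : realType) (l a b : R) : 1 <= l -> 0 <= a -> a <= b ->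
  (b - a) * (l * exp_remainder (l * a) + a) <=
  exp_remainder (l * b) - exp_remainder (l * a).
Proof.
move=> l1 a0 ab; rewrite /exp_remainder.
have -> : expR (l * b) = expR (l * a) * expR (l * (b - a)).
  by rewrite -expRD; congr expR; ring.
have := ler_wpM2l (expR_ge0 (l * a)) (expR_ge1Dx (l * (b - a))).
have : 0 <= (l * l - 1) * (a * (b - a)).
  rewrite mulr_ge0 ?subr_ge0 ?mulr_ege1 //.
  by rewrite mulr_ge0 // subr_ge0.
lra.
Qed.

(** * Least supersolutions of nonnegative systems *)

Section NonnegativeSystem.
Variables (R : realType) (X : set R) (n k : nat) (M : 'M[R]_n).
Hypotheses (hX : half_line X) (M0 : 0 <=mx M).

(** The Euler inequality is imposed on all pairs of points, so no derivative occurs and infima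
    inherit it. *)
Definition supersolution (x : R -> 'M[R]_(n, k)) : Prop :=
  forall a b, X a -> X b -> a <= b -> x a + (b - a) *: (M *m x a) <=mx x b.

Let l := 1 + n%:R * `|M|.

Let l1 : 1 <= l. Proof. by rewrite lerDl mulr_ge0. Qed.

Definition majorant (y : 'M[R]_(n, k)) (s : R) : 'M[R]_(n, k) :=
  y + s *: (M *m y)
    + (exp_remainder (l * s) * `|M *m (M *m y)|) *: const_mx 1.

Lemma majorant0 y : majorant y 0 = y.
Proof.
by rewrite /majorant scale0r addr0 /exp_remainder mulr0 expR0 subrr subr0 mul0r
  scale0r addr0.
Qed.

(** With [q = M (M y)], the second-order term [a q] is at most [a |q|] and the row sums of [M] are
    at most [l], so the claim is [exp_remainder_step] scaled by [|q|]. *)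
Lemma majorant_step y a b : 0 <= a -> a <= b ->
  majorant y a + (b - a) *: (M *m majorant y a) <=mx majorant y b.
Proof.
move=> a0 ab i j; rewrite /majorant !mulmxDr -!scalemxAr.
set q := M *m (M *m y); set o := M *m const_mx 1.
have qq : q i j <= `|q| by rewrite (le_trans (ler_norm _)) // mx_entry_norm.
have ol : o i j <= l.
  rewrite (le_trans (ler_norm _)) // (le_trans (mx_entry_norm _ _ _)) //.
  rewrite (le_trans (mulmx_norm _ _)) // /l ler_wpDl // ler_piMr ?mulr_ge0 //.
  by apply: mx_norm_le => // i' j'; rewrite mxE normr1.
have := exp_remainder_step l1 a0 ab => /(ler_wpM2r (normr_ge0 q)).
have e0 := exp_remainder_ge0 (l * a).
move: (exp_remainder (l * a)) (exp_remainder (l * b)) e0 => ea eb e0 h.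
have ba0 : 0 <= b - a by rewrite subr_ge0.
have h1 := ler_wpM2l (mulr_ge0 a0 ba0) qq.
have h2 := ler_wpM2l (mulr_ge0 (mulr_ge0 ba0 e0) (normr_ge0 q)) ol.
move: (M *m y) q o qq ol h h1 h2 => p q o qq ol h h1 h2.
by rewrite !mxE; lra.
Qed.

Lemma supersolution_ge0 x : supersolution x -> 0 <=mx x 0 ->
  forall t, X t -> 0 <=mx x t.
Proof.
move=> sx x00 t Xt; have [_ X0 Xpos _] := hX.
apply: lemx_trans (sx 0 t X0 Xt (Xpos _ Xt)); rewrite -[0]addr0 subr0.
by apply: lemxD => //; rewrite -(scaler0 _ t); apply: lemxZ (Xpos _ Xt) _;
  rewrite -(mulmx0 _ M); exact: lemxM.
Qed.

Lemma supersolution_mono x : supersolution x -> 0 <=mx x 0 ->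
  forall a b, X a -> X b -> a <= b -> x a <=mx x b.
Proof.
move=> sx x00 a b Xa Xb ab; apply: lemx_trans (sx _ _ Xa Xb ab).
rewrite -[X in X <=mx _]addr0; apply: lemxD => //.
rewrite -(scaler0 _ (b - a)); apply: lemxZ; first by rewrite subr_ge0.
by rewrite -(mulmx0 _ M); apply: lemxM => //; exact: supersolution_ge0.
Qed.

(* [r] and [t] are either equal or consecutive points of [X]. *)
Lemma supersolution_splice x r t : supersolution x -> 0 <=mx x 0 ->
  X r -> X t -> r <= t -> (forall s, X s -> r < s -> t <= s) ->
  supersolution (fun s => if s <= r then x s else
    majorant (x r + (t - r) *: (M *m x r)) (s - t)).
Proof.
move=> sx x00 Xr Xt rt rs a b Xa Xb ab.
set y := x r + _.
have [br|rb] := leP b r; first by rewrite (le_trans ab br); exact: sx.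
have tb := rs _ Xb rb; have [ar|ra] := leP a r; last first.
  have ta := rs _ Xa ra; have := @majorant_step y (a - t) (b - t).
  by rewrite (_ : b - t - (a - t) = b - a); [apply; lra | ring].
have := @majorant_step y 0 (b - t) (lexx _); rewrite subr0 majorant0 subr_ge0.
move=> /(_ tb); apply: lemx_trans.
have xry : x r <=mx y.
  rewrite -[X in X <=mx _]addr0; apply: lemxD => //.
  rewrite -(scaler0 _ (t - r)); apply: lemxZ; first by rewrite subr_ge0.
  by rewrite -(mulmx0 _ M); apply: lemxM => //; exact: supersolution_ge0.
apply: lemx_trans (lemxD (lemx_refl y) (lemxZ _ (lemxM M0 xry))); last first.
  by rewrite subr_ge0.
rewrite /y -addrA -scalerDl (_ : t - r + (b - t) = b - r); last by ring.
apply: lemx_trans (lemxD (sx _ _ Xa Xr ar) (lemxZ _ (lemxM M0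
  (supersolution_mono sx x00 Xa Xr ar)))); last by rewrite subr_ge0 ltW.
by rewrite -addrA -scalerDl (_ : r - a + (b - r) = b - a) //; ring.
Qed.

Variable x0 : 'M[R]_(n, k).
Hypothesis x00 : 0 <=mx x0.

(** At points of [X] these infima are genuine: the family contains the majorant of [x0], and 0 is a
    lower bound. *)
Definition least_supersolution (t : R) : 'M[R]_(n, k) :=
  \matrix_(i, j) inf [set f t i j | f in
    [set f : R -> 'M[R]_(n, k) | supersolution f /\ x0 <=mx f 0]].

Local Notation x := least_supersolution.

Let candidate : exists2 f, supersolution f & f 0 = x0.
Proof.
exists (majorant x0) => [a b Xa Xb|]; last exact: majorant0.
by have [_ _ Xpos _] := hX; apply: majorant_step; exact: Xpos.
Qed.

Lemma least_supersolution_le f t : X t -> supersolution f -> x0 <=mx f 0 ->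
  x t <=mx f t.
Proof.
move=> Xt sf f0 i j; rewrite mxE; apply: ge_inf; last by exists f.
exists 0 => _ [g [sg g0] <-].
by have := supersolution_ge0 sg (lemx_trans x00 g0) Xt i j; rewrite mxE.
Qed.

Lemma least_supersolution_ge t y : X t ->
  (forall f, supersolution f -> x0 <=mx f 0 -> y <=mx f t) -> y <=mx x t.
Proof.
move=> Xt yf i j; rewrite mxE; apply: lb_le_inf => [|_ [f [sf f0] <-]].
  have [f sf f0] := candidate; exists (f t i j), f => //.
  by split=> //; rewrite f0.
exact: yf.
Qed.

Lemma least_supersolution0 : x 0 = x0.
Proof.
have [_ X0 _ _] := hX; have [f sf f0] := candidate.
have lef := least_supersolution_le X0 sf; rewrite f0 in lef.
have gef := @least_supersolution_ge 0 x0 X0 (fun _ _ => id).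
by apply/matrixP => i j; apply/eqP; rewrite eq_le lef // gef.
Qed.

(** As [M] is nonnegative, an Euler step from the infimum lies below the same step from any member
    of the family. *)
Lemma least_supersolution_super : supersolution x.
Proof.
move=> a b Xa Xb ab; apply: least_supersolution_ge => // f sf f0.
apply: lemx_trans (sf _ _ Xa Xb ab); have xf := least_supersolution_le Xa sf f0.
by apply: lemxD => //; apply: lemxZ; [rewrite subr_ge0 | exact: lemxM].
Qed.

Let x_ge0 : 0 <=mx x 0. Proof. by rewrite least_supersolution0. Qed.

(** Replacing [x] after [r] by the majorant gives a competing supersolution; minimality does the
    rest. *)
Lemma least_supersolution_majorant r t s : X r -> X t -> r <= t ->
  (forall s, X s -> r < s -> t <= s) -> X s -> r < s ->
  x s <=mx majorant (x r + (t - r) *: (M *m x r)) (s - t).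
Proof.
move=> Xr Xt rt rs Xs ls; have [_ _ Xpos _] := hX.
have sp := supersolution_splice least_supersolution_super x_ge0 Xr Xt rt rs.
have := least_supersolution_le Xs sp.
by rewrite (Xpos _ Xr) leNgt ls least_supersolution0; exact.
Qed.

Lemma least_supersolution_jump t : X t ->
  x (fwd_jump X t) = x t + (fwd_jump X t - t) *: (M *m x t).
Proof.
move=> Xt; have [->|jt] := eqVneq (fwd_jump X t) t.
  by rewrite subrr scale0r addr0.
have Xj := fwd_jump_in hX t; have tj := fwd_jump_ge hX t.
have ltj : t < fwd_jump X t by rewrite lt_neqAle eq_sym jt.
have up := least_supersolution_majorant Xt Xj tj (@fwd_jump_le _ _ hX t) Xj ltj.
rewrite subrr majorant0 in up; have dn := least_supersolution_super Xt Xj tj.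
by apply/matrixP => i j; apply/eqP; rewrite eq_le up dn.
Qed.

Lemma least_supersolution_delta t : X t -> delta_derivative X x t (M *m x t).
Proof.
move=> Xt; have [_ _ _ /(_ (t + 1))[N XN tN]] := hX.
have l0 : 0 < l by exact: lt_le_trans l1.
set c := n%:R * `|M|; have c0 : 0 <= c by rewrite mulr_ge0.
(* As [d <= 1], points within [d] of [t] lie before [N], and monotonicity bounds [x] there by [x N].
   Two such points also satisfy [l * (b - a) <= 1 / 2], as [exp_remainder_le] requires. *)
set d := 1 / (4 * l).
have ld : l * d = 1 / 4 by rewrite /d; field; rewrite lt0r_neq0.
have d1 : d <= 1.
  by rewrite -(ler_pM2l l0) ld mulr1; have := l1; lra.
have d0 : 0 < d by rewrite -(pmulr_rgt0 _ l0) ld; lra.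
have xN a : X a -> `|a - t| < d -> `|x a| <= `|x N|.
  move=> Xa; rewrite ltr_norml => ad; have s := least_supersolution_super.
  by apply: lemx_norm; [exact: supersolution_ge0 | apply: supersolution_mono => //; lra].
set C := `|x N| + 2 * l ^+ 2 * (c * (c * `|x N|)).
have xNC : `|x N| <= C by rewrite lerDl !mulr_ge0 // ltW.
apply: (@delta_derivative_quadratic _ _ _ _ _ _ _ C d) => //.
- exact: least_supersolution_jump.
- by move=> a Xa ad; exact: le_trans (xN _ Xa ad) xNC.
move=> a b Xa Xb ad bd; rewrite le_eqVlt => /predU1P[<-|ab].
  by rewrite !subrr scale0r subr0 normr0 mulr_ge0 ?sqr_ge0 // (le_trans _ xNC).
(* The splice is made at [a] itself: the majorant bounds [x b] above and the Euler step bounds it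
   below, with gap [E]. *)
have := least_supersolution_majorant Xa Xa (lexx _) (fun s _ => @ltW _ _ a s) Xb ab.
rewrite subrr scale0r addr0 /majorant => up.
have lo := least_supersolution_super Xa Xb (ltW ab).
set E := exp_remainder _ * _ in up.
have xE : `|x b - x a - (b - a) *: (M *m x a)| <= E.
  apply: mx_norm_le => [|i j]; first by rewrite mulr_ge0 // exp_remainder_ge0.
  move: (up i j) (lo i j); move: (M *m x a) => p; rewrite !mxE => h1 h2.
  by rewrite ger0_norm; lra.
apply: le_trans xE _.
have MM : `|M *m (M *m x a)| <= c * (c * `|x N|).
  apply: le_trans (mulmx_norm _ _) _; apply: ler_wpM2l => //.
  by apply: le_trans (mulmx_norm _ _) _; apply: ler_wpM2l => //; exact: xN.
have ba : 0 <= l * (b - a) by rewrite mulr_ge0 ?subr_ge0 // ltW.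
have ba2 : l * (b - a) <= 1 / 2.
  have : b - a <= 2 * d by move: ad bd; rewrite !ltr_norml; lra.
  by rewrite -(ler_pM2l l0) mulrCA ld; lra.
apply: le_trans (ler_pM (exp_remainder_ge0 _) _ (exp_remainder_le ba ba2) MM) _ => //.
rewrite (_ : 2 * _ * _ = 2 * l ^+ 2 * (c * (c * `|x N|)) * (b - a) ^+ 2); last by ring.
apply: ler_wpM2r; first exact: sqr_ge0.
by rewrite lerDr.
Qed.

End NonnegativeSystem.

(* Writing [A] as a difference of nonnegative matrices [P - N], the difference
   [y - w] solves the system of [A] when [(y, w)] solves that of [P N; N P]. *)
Lemma fundamental_matrix (R : realType) (X : set R) (n : nat) (A : 'M[R]_n) :
  half_line X -> exists Phi : R -> 'M[R]_n, Phi 0 = 1%:M /\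
    forall t, X t -> delta_derivative X Phi t (A *m Phi t).
Proof.
move=> hX; pose P := map_mx (fun a => Num.max a 0) A; pose N := P - A.
have P0 i j : 0 <= P i j by rewrite mxE le_max lexx orbT.
have N0 i j : 0 <= N i j by rewrite !mxE subr_ge0 le_max lexx.
pose M := block_mx P N N P; pose z0 : 'M[R]_(n + n, n) := col_mx 1%:M 0.
have M0 : 0 <=mx M.
  by move=> i j; rewrite mxE /M block_mxEv /col_mx mxE; case: splitP => i' _;
    rewrite mxE; case: splitP.
have z00 : 0 <=mx z0.
  move=> i j; rewrite mxE /z0 /col_mx mxE; case: splitP => i' _; rewrite mxE //.
pose D := row_mx 1%:M (- 1%:M) : 'M[R]_(n, n + n).
have DM : D *m M = A *m D.
  rewrite mul_row_block mul_mx_row !mulNmx !mul1mx mulmx1 mulmxN mulmx1.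
  by rewrite /N opprB addrC subrK (addrC (P - A)) addrA addNr add0r.
exists (fun t => D *m least_supersolution X M z0 t); split.
  rewrite least_supersolution0 // mul_row_col mulmx0 addr0 mulmx1 //.
move=> t Xt; rewrite mulmxA -DM -mulmxA; apply: delta_derivative_mulmxl.
exact: least_supersolution_delta.
Qed.

(** * Exponentials, their growth, and smooth solutions *)

Lemma scalar_exponential (R : realType) (X : set R) (lam : R) :
  half_line X -> 0 <= lam -> exists E : R -> 'M[R]_1,
    [/\ E 0 = 1%:M, supersolution X lam%:M E &
      forall t, X t -> delta_derivative X E t (lam *: E t)].
Proof.
move=> hX lam0; have L0 : (0 : 'M[R]_1) <=mx lam%:M.
  by move=> i j; rewrite !ord1 !mxE.
have I0 : (0 : 'M[R]_1) <=mx 1%:M by move=> i j; rewrite !ord1 !mxE.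
exists (least_supersolution X lam%:M 1%:M); split.
- exact: least_supersolution0.
- exact: least_supersolution_super.
- move=> t Xt; rewrite -mul_scalar_mx; exact: least_supersolution_delta.
Qed.

(** Each Euler step across a gap [t - s] gains at least a factor [(t - s) * lam]; [d] is the product
    of [n] gaps. Both [tf] and [d] are independent of [lam]. *)
Lemma scalar_exponential_growth (R : realType) (X : set R) (n : nat) :
  half_line X -> exists tf d : R, [/\ X tf, 0 < tf, 0 < d &
    forall (lam : R) (E : R -> 'M[R]_1), 0 <= lam -> E 0 = 1%:M ->
      supersolution X lam%:M E -> d * lam ^+ n <= E tf 0 0].
Proof.
move=> hX; have [_ X0 _ Xub] := hX.
have step lam (E : R -> 'M[R]_1) a b : supersolution X lam%:M E ->
    X a -> X b -> a <= b -> E a 0 0 + (b - a) * (lam * E a 0 0) <= E b 0 0.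
  move=> sE Xa Xb ab; have := sE _ _ Xa Xb ab 0 0.
  by rewrite mul_scalar_mx !mxE.
elim: n => [|n [s [d [Xs s0 d0 IH]]]].
  have [s Xs s0] := Xub 0; exists s, 1; split=> // lam E lam0 E0 sE.
  have := step _ _ _ _ sE X0 Xs (ltW s0); rewrite E0 mxE eqxx mulr1n expr0.
  by have := mulr_ge0 (ltW s0) lam0; lra.
have [t Xt st] := Xub s; exists t, (d * (t - s)); split=> //.
- exact: lt_trans st.
- by rewrite mulr_gt0 // subr_gt0.
move=> lam E lam0 E0 sE; have h := IH _ _ lam0 E0 sE.
apply: le_trans (step _ _ _ _ sE Xs Xt (ltW st)).
have ts0 : 0 <= t - s by rewrite subr_ge0 ltW.
have h2 := ler_wpM2l (mulr_ge0 ts0 lam0) h.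
have : 0 <= d * lam ^+ n by rewrite mulr_ge0 ?exprn_ge0 // ltW.
by rewrite exprS; lra.
Qed.

(** If [b] is nonzero, [d X^n b] has larger degree than [a], so the difference of squares [q] is
    eventually positive, against the bound. Squaring disposes of the absolute values. *)
Lemma growth_poly_eq0 (R : rcfType) (n : nat) (d l : R) (a b : {poly R}) :
  0 < d -> (size a <= n)%N ->
  (forall x, l <= x -> d * x ^+ n * `|b.[x]| <= `|a.[x]|) -> b = 0.
Proof.
move=> d0 an ab; apply: contrapT => /eqP b0.
pose c := d *: ('X^n * b); pose q := c ^+ 2 - a ^+ 2.
have sc : size c = (n + size b)%N.
  by rewrite size_scale ?lt0r_neq0 // mulrC size_mulXn.
have c0 : c != 0 by rewrite -size_poly_gt0 sc addn_gt0 size_poly_gt0 b0 orbT.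
have szc : size (c ^+ 2) = (2 * size c).-1.
  by rewrite expr2 size_mul // addnn mul2n.
have sac : (size a < size c)%N.
  by rewrite sc (leq_ltn_trans an) // -[X in (X < _)%N]addn0 ltn_add2l size_poly_gt0.
have sza : (size (- a ^+ 2) < size (c ^+ 2))%N.
  rewrite size_opp szc; have [->|a0] := eqVneq a 0.
    rewrite expr0n size_poly0; move: c0; rewrite -size_poly_gt0.
    by case: (size c) => // i _; rewrite mulnS.
  rewrite expr2 size_mul // addnn -mul2n.
  rewrite -ltnS !prednK ?muln_gt0 ?size_poly_gt0 //.
  by rewrite ltn_pmul2l.
have lq : 0 < lead_coef q.
  by rewrite lead_coefDl // [c ^+ 2]expr2 lead_coefM -expr2 exprn_even_gt0 //= lead_coef_eq0.
have [N Nq] := poly_pinfty_gt_lc lq.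
pose x := Num.max N (Num.max l 0).
have := Nq x; rewrite le_max lexx => /(_ isT) /(lt_le_trans lq).
have xl : l <= x by rewrite !le_max lexx !orbT.
have x0 : 0 <= x by rewrite !le_max lexx !orbT.
rewrite hornerD hornerN !horner_exp subr_gt0 hornerZ hornerM hornerXn ltNge => /negP[].
rewrite -(real_normK (num_real (d * _))) -(real_normK (num_real a.[x])).
rewrite ler_sqr ?nnegrE // mulrA normrM ger0_norm ?mulr_ge0 ?exprn_ge0 ?(ltW d0) //.
exact: ab.
Qed.

Lemma delta_derivative_rd_continuous (R : realType) (X : set R)
    (V : normedModType R) (u : R -> V) :
  (forall t, X t -> exists L, delta_derivative X u t L) -> rd_continuous X u.
Proof.
move=> uD t Xt; have [L uL] := uD t Xt.
have cu e : 0 < e -> \forall s \near nbhs t, X s -> `|u t - u s| <= e.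
  move=> e0; have [d d0 dP] := delta_derivative_dist Xt uL e0.
  by rewrite -near_withinE; apply/near_withinP; exists d.
split=> _; [|exists (u t)]; apply/cvgrPdist_le => e e0; rewrite near_withinE.
  exact: cu.
by rewrite near_withinE; apply: filterS (cu e e0) => s us _.
Qed.

Section Solutions.
Variables (R : realType) (X : set R) (n m : nat).
Variables (A : 'M[R]_n) (B : 'M[R]_(n, m)).

(** Differentiability of the input is a convenient sufficient condition for rd-continuity; the
    initial state is left free so that these pairs form a vector space. *)
Definition smooth_solution (u : R -> 'cV[R]_m) (x : R -> 'cV[R]_n) : Prop :=
  forall t, X t -> (exists L, delta_derivative X u t L) /\
    delta_derivative X x t (A *m x t + B *m u t).

Lemma smooth_solution_lin a u v x y :
  smooth_solution u x -> smooth_solution v y ->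
  smooth_solution (fun t => a *: u t + v t) (fun t => a *: x t + y t).
Proof.
move=> ux vy t Xt; have [[L uL] xD] := ux t Xt; have [[M vM] yD] := vy t Xt.
split; first by exists (a *: L + M); apply: delta_derivativeD => //;
  exact: delta_derivativeZ.
rewrite !mulmxDr addrACA -!scalemxAr -scalerDr.
by apply: delta_derivativeD => //; exact: delta_derivativeZ.
Qed.

Lemma smooth_solution0 : smooth_solution (fun=> 0) (fun=> 0).
Proof.
have D0 k t : delta_derivative X (fun=> 0 : 'cV[R]_k) t 0.
  apply/delta_derivativeP => e e0; exists 1 => // s _ _.
  by rewrite scaler0 !subr0 normr0 mulr_ge0 // ltW.
by move=> t Xt; rewrite !mulmx0 addr0; split; [exists 0|]; exact: D0.
Qed.

(* The response to the exponential input [det (lam - A) v E], computed with the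
   particular solution [adj (lam - A) B v E]. *)
Lemma smooth_solution_exp (Phi : R -> 'M[R]_n) (E : R -> 'M[R]_1) lam
    (v : 'cV[R]_m) :
  (forall t, X t -> delta_derivative X Phi t (A *m Phi t)) ->
  (forall t, X t -> delta_derivative X E t (lam *: E t)) ->
  let w := \adj (lam%:M - A) *m (B *m v) in
  smooth_solution (fun t => (\det (lam%:M - A) *: v) *m E t)
    (fun t => w *m E t - Phi t *m w).
Proof.
move=> PhiD ED w t Xt; split.
  by exists ((\det (lam%:M - A) *: v) *m (lam *: E t));
    apply: delta_derivative_mulmxl; exact: ED.
have E1 : lam *: w = A *m w + \det (lam%:M - A) *: (B *m v).
  have : (lam%:M - A) *m w = \det (lam%:M - A) *: (B *m v).
    by rewrite mulmxA mul_mx_adj mul_scalar_mx.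
  by rewrite mulmxBl mul_scalar_mx => <-; rewrite addrC subrK.
rewrite (_ : A *m _ + B *m _ = w *m (lam *: E t) + - (A *m Phi t) *m w); last first.
  have -> : w *m (lam *: E t) = (A *m w + \det (lam%:M - A) *: (B *m v)) *m E t.
    by rewrite -E1 -scalemxAl scalemxAr.
  rewrite mulmxDl mulmxBr mulNmx addrAC -!scalemxAl -scalemxAr.
  by rewrite !mulmxA.
have -> : (fun s => w *m E s - Phi s *m w) =
    (fun s => w *m E s + (-1) *: Phi s *m w).
  by apply/funext => s; rewrite scaleN1r mulNmx.
apply: delta_derivativeD; first exact/delta_derivative_mulmxl/ED.
apply: delta_derivative_mulmxr; rewrite -(scaleN1r (A *m _)).
exact/delta_derivativeZ/PhiD.
Qed.

End Solutions.

(** * Controllability and observability *)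

Lemma smooth_steering (R : realType) (X : set R) (n m : nat)
    (A : 'M[R]_n) (B : 'M[R]_(n, m)) :
  half_line X -> reachable_pair A B ->
  exists tf, [/\ X tf, 0 < tf & forall x0 xf : 'cV[R]_n, exists u x,
    [/\ smooth_solution X A B u x, x 0 = x0 & x tf = xf]].
Proof.
move=> hX rAB; have [tf [d [Xtf tf0 d0 growth]]] := scalar_exponential_growth n hX.
have [Phi [Phi0 PhiD]] := fundamental_matrix A hX.
exists tf; split=> // x0 xf.
pose S v := exists u x, [/\ smooth_solution X A B u x, x 0 = 0 & x tf = v].
(* Removing the free response [Phi t *m x0] reduces steering to reaching states from 0. *)
suff [u [x [ux x00 xtf]]] : S (xf - Phi tf *m x0).
  exists (fun t => 1 *: u t + 0), (fun t => 1 *: x t + Phi t *m x0); split.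
  - apply: smooth_solution_lin => // t Xt; split.
      by have [] := smooth_solution0 A B Xt.
    by rewrite mulmx0 addr0 mulmxA; exact/delta_derivative_mulmxr/PhiD.
  - by rewrite x00 scaler0 add0r Phi0 mul1mx.
  - by rewrite xtf scale1r subrK.
move: {xf x0} (xf - _); apply: subspace_full.
- by exists (fun=> 0), (fun=> 0); split=> //; exact: smooth_solution0.
- move=> a v v' [u [x [ux x0 xv]]] [u' [x' [ux' x'0 xv']]].
  exists (fun t => a *: u t + u' t), (fun t => a *: x t + x' t); split.
  + exact: smooth_solution_lin.
  + by rewrite x0 x'0 scaler0 addr0.
  + by rewrite xv xv'.
(* If [q] kills all states reached from 0, the exponential inputs make the resolvent polynomial of
   [q] too small compared with that of [q *m Phi tf], unless it is 0. *)
move=> q Sq; apply: rAB => i; apply: resolvent_poly_eq0.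
apply/matrixP => r c; rewrite [RHS]mxE !ord1.
apply: (@growth_poly_eq0 _ n d 0 (resolvent_poly A B (q *m Phi tf) 0 c)) => //.
  exact: size_resolvent_poly.
move=> lam lam0; have [E [E0 sE ED]] := scalar_exponential hX lam0.
pose v : 'cV[R]_m := delta_mx c 0.
pose w := \adj (lam%:M - A) *m (B *m v).
have ev (C : 'rV[R]_n) : (resolvent_poly A B C 0 c).[lam] = (C *m w) 0 0.
  have /matrixP/(_ 0 c) := resolvent_poly_eval A B C lam.
  rewrite [LHS]mxE /horner_eval => ->.
  by rewrite /w !mulmxA -colE [RHS]mxE.
have Sw : S (w *m E tf - Phi tf *m w).
  eexists; eexists; split.
  - exact: (smooth_solution_exp B v PhiD ED).
  - by rewrite /= E0 Phi0 mul1mx mulmx1 subrr.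
  - by [].
clearbody w; have /matrixP/(_ 0 0) := Sq _ Sw.
rewrite mulmxBr !mulmxA => /eqP.
rewrite [X in X == _]mxE [X in _ == X]mxE [X in _ + X]mxE subr_eq0 => /eqP qw.
rewrite !ev -qw [(q *m w *m E tf) 0 0]mxE big_ord1 normrM mulrC ler_wpM2l //.
by rewrite (le_trans (growth _ _ lam0 E0 sE)) // ler_norm.
Qed.

Section Systems.
Variables (R : realType) (T : set R) (n m p : nat).
Variables (A : 'M[R]_n) (B : 'M[R]_(n, m)) (C : 'M[R]_(p, n)).
Hypothesis hT : half_line (from_time T 0).

Lemma reachable_controllable : reachable_pair A B -> controllable T A B.
Proof.
move=> rAB; have [tf [[Ttf _] tf0 steer]] := smooth_steering hT rAB.
exists tf; split=> // x0 xf; have [u [x [ux x0E xfE]]] := steer x0 xf.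
exists u; split.
  by apply: delta_derivative_rd_continuous => t /ux[].
by exists x; split=> //; split=> // t /ux[].
Qed.

(** For the unobservable basis [P] of the transposed pair, [P^T x] solves a homogeneous equation
    because [P^T B = 0]. Started at 0 it stays 0, so [q], which factors through [P^T], kills every
    final state. *)
Lemma controllable_reachable : controllable T A B -> reachable_pair A B.
Proof.
move=> [tf [Ttf tf0 ctrl]] q qAB.
have [k [P [A' [AP CP Pw]]]] := unobservable_basis A^T B^T.
have [w qw] : exists w, q^T = P *m w.
  by apply: Pw => i; rewrite -trmxX -!trmx_mul mulmxA qAB trmx0.
have Xtf : from_time T 0 tf by split=> //; exact: ltW.
have qx (xf : 'cV[R]_n) : q *m xf = 0.
  have [u [_ [x [[x0 xD] <-]]]] := ctrl 0 xf.
  suff Px : P^T *m x tf = 0 by rewrite -[q]trmxK qw trmx_mul -mulmxA Px mulmx0.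
  apply: (@delta_homogeneous_eq0 _ _ _ _ A'^T (fun t => P^T *m x t) hT) => //.
    move=> t Xt; rewrite mulmxA -trmx_mul -AP trmx_mul trmxK.
    have PB : P^T *m B = 0 by apply: trmx_inj; rewrite trmx_mul trmxK CP trmx0.
    rewrite [X in delta_derivative _ _ _ X](_ : _ = P^T *m (A *m x t + B *m u t)).
      exact/delta_derivative_mulmxl/xD.
    by rewrite mulmxDr !mulmxA PB mul0mx addr0.
  by rewrite x0 mulmx0.
by rewrite -[q]mulmx1; apply/matrixP => i j;
  have /matrixP/(_ i 0) := qx (delta_mx j 0); rewrite -colE mulmx1 !mxE.
Qed.

(** A trajectory from an unobservable [v = P w] is built inside the range of [P], as [P Phi w] with
    [Phi] the fundamental matrix of the restriction [A']. Its output is 0, like that of the zero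
    trajectory. *)
Lemma observable_observable_pair : observable T A B C -> observable_pair A C.
Proof.
move=> [tf [Ttf tf0 obs]] v vAC.
have [k [P [A' [AP CP Pw]]]] := unobservable_basis A C.
have [w vw] := Pw v vAC; have [Phi [Phi0 PhiD]] := fundamental_matrix A' hT.
apply: (obs v 0 (fun t => P *m Phi t *m w) (fun=> 0)).
- split; first by rewrite Phi0 mulmx1.
  move=> t Xt; rewrite mulmx0 addr0 !mulmxA AP -(mulmxA P).
  exact/delta_derivative_mulmxr/delta_derivative_mulmxl/PhiD.
- by split=> // t Xt; have [_] := smooth_solution0 A B Xt.
- by move=> t _ _ _; rewrite !mulmxA CP !mul0mx mulmx0.
Qed.

End Systems.

(** * Observability by repeated differentiation *)

(** Measures how often a zero output can be differentiated at [t]: each differentiation consumes one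
    later point. *)
Fixpoint points_before (R : realType) (X : set R) (tf : R) (k : nat) (t : R) : Prop :=
  if k is i.+1 then exists p, [/\ X p, t < p & points_before X tf i p] else t < tf.

Section PointsBefore.
Variables (R : realType) (X : set R).

Lemma points_before_exists k t : half_line X ->
  exists2 tf, X tf & points_before X tf k t.
Proof.
move=> [_ _ _ Xub]; elim: k t => [|k IH] t.
  by have [s Xs ts] := Xub t; exists s.
have [s Xs ts] := Xub t; have [tf Xtf stf] := IH s.
by exists tf => //; exists s.
Qed.

Lemma points_before_le tf k s t : s <= t ->
  points_before X tf k t -> points_before X tf k s.
Proof.
case: k => [|k] /=; first exact: le_lt_trans.
by move=> st [r [Xr tr rtf]]; exists r; split=> //; exact: le_lt_trans tr.
Qed.

Lemma points_before_lt tf k t : points_before X tf k t -> t < tf.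
Proof.
by elim: k t => [//|k IH] t [r [_ tr /IH rtf]]; exact: lt_trans rtf.
Qed.

Lemma points_beforeW tf i k t : (i <= k)%N ->
  points_before X tf k t -> points_before X tf i t.
Proof.
elim: k i t => [|k IH] [|i] t //= ik; last first.
  by move=> [r [Xr tr rtf]]; exists r; split=> //; exact: IH rtf.
by move=> [r [_ tr /points_before_lt]]; exact: lt_trans.
Qed.

(** One later point [r] suffices: if [t] is right-scattered its jump is at most [r] and the jump
    formula applies; if right-dense, points of [X] between [t] and [r] come arbitrarily close to
    [t]. *)
Lemma delta_derivative_eq0 (V : normedModType R) (f : R -> V) t r (L : V) :
  half_line X -> X t -> X r -> t < r ->
  (forall s, X s -> t <= s -> s <= r -> f s = 0) ->
  delta_derivative X f t L -> L = 0.
Proof.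
move=> hX Xt Xr tr f0 fL.
have jr := fwd_jump_le hX Xr tr; have tj := fwd_jump_ge hX t.
have [jt|jt] := eqVneq (fwd_jump X t) t; last first.
  have := delta_derivative_jump Xt fL.
  rewrite !f0 ?lexx ?(ltW tr) //; last exact: fwd_jump_in.
  by rewrite add0r => /esym/eqP; rewrite scaler_eq0 subr_eq0 (negPf jt) => /eqP.
apply/eqP; rewrite -normr_le0; apply: le0_eps => e e0.
have /delta_derivativeP/(_ e e0)[d d_gt0 dP] := fL.
have m0 : 0 < Order.min d (r - t) by rewrite lt_min d_gt0 subr_gt0.
have [s [Xs ts]] := fwd_jump_near hX t m0.
rewrite jt -ltrBlDl lt_min => /andP[sd sr].
have := dP s Xs; rewrite jt !f0 ?lexx ?(ltW tr) ?(ltW ts) //; last by lra.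
rewrite subrr sub0r normrN normrZ mulrC ler_pM2r; last first.
  by rewrite normr_gt0 subr_eq0 lt_eqF.
by apply; rewrite ger0_norm ?subr_ge0 ?ltW.
Qed.

End PointsBefore.

Lemma observable_pair_observable (R : realType) (T : set R) (n m p : nat)
    (A : 'M[R]_n) (B : 'M[R]_(n, m)) (C : 'M[R]_(p, n)) :
  half_line (from_time T 0) -> observable_pair A C -> observable T A B C.
Proof.
move=> hT oAC; have [_ X0 _ _] := hT.
have [tf Xtf tfn] := points_before_exists n 0 hT; have tf0 := points_before_lt tfn.
exists tf; split=> // [|x0 x0' x x' [x0E xD] [x0'E xD'] Cxx'].
  by case: Xtf.
pose z t := x t + (-1) *: x' t.
have zD t : from_time T 0 t -> delta_derivative (from_time T 0) z t (A *m z t).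
  move=> Xt; have := xD' t Xt; have := xD t Xt; rewrite mulmx0 !addr0 => h h'.
  rewrite mulmxDr -scalemxAr; apply: delta_derivativeD => //.
  exact: delta_derivativeZ.
(* [C A^k z] vanishes from [t] to the next counted point [r], so its derivative [C A^(k+1) z]
   vanishes at [t]. At 0 this covers all exponents below [n], enough by [mxpow_lt_dim]. *)
have key k t : from_time T 0 t -> points_before (from_time T 0) tf k t ->
    C *m A ^+ k *m z t = 0.
  elim: k t => [|k IH] t Xt.
    case: Xt => Tt t0 ttf; rewrite expr0 mulmx1 /z mulmxDr -scalemxAr.
    by rewrite Cxx' // scaleN1r subrr.
  move=> [r [Xr tr rtf]].
  have := delta_derivative_mulmxl (C *m A ^+ k) (zD t Xt).
  move=> /(delta_derivative_eq0 hT Xt Xr tr).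
  rewrite mulmxA -(mulmxA C) -[_ *m A]/(_ * A) -exprSr; apply=> s Xs _ sr.
  by apply: IH => //; exact: points_before_le rtf.
have : z 0 = 0.
  apply: oAC; apply: mxpow_lt_dim => i ni; apply: key => //.
  exact: points_beforeW (ltnW ni) tfn.
by rewrite /z x0E x0'E scaleN1r => /eqP; rewrite subr_eq0 => /eqP.
Qed.

Lemma half_line_from_time (R : realType) (T : set R) :
  time_scale T -> unbounded_above T -> T 0 -> half_line (from_time T 0).
Proof.
move=> [cT _] uT T0; split=> [|||r].
- by apply: closedI => //; exact: closed_ge.
- by split=> /=.
- by move=> t [].
apply: contrapT => h; apply: uT; exists (Num.max r 0) => t Tt.
rewrite leNgt; apply/negP; rewrite gt_max => /andP[rt t0].
by apply: h; exists t => //; split=> //=; exact: ltW.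
Qed.

Theorem theorem4p6 (R : realType) (T : set R) (n m p : nat)
    (A : 'M[R]_n) (B : 'M[R]_(n, m)) (C : 'M[R]_(p, n))
    (G : R[i] -> 'M[R[i]]_(p, m)) :
  time_scale T -> unbounded_above T -> bounded_graininess T -> T 0 ->
  regressive T A ->
  realization A B C G ->
  (minimal_realization T A B C G <->
   controllable T A B /\ observable T A B C).
Proof.
move=> tsT uT _ T0 rA ABC; have hT := half_line_from_time tsT uT T0.
split=> [[_ minABC]|[ctrl obs]].
  split.
    apply: reachable_controllable => //; apply: contrapT => /reachable_restriction.
    move=> [k [P [L [A' [B' [kn LP AP BP]]]]]]; apply: minABC; exists k; split=> //.
    exists A', B', (C *m P); split; first exact: regressive_restrict LP AP rA.
    exact: realization_restrict LP AP BP ABC.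
  apply: observable_pair_observable => //; apply: contrapT => noAC.
  (* The transposed system is reduced to its reachable subspace, and the smaller realization is
     transposed back. *)
  have : ~ reachable_pair A^T C^T by move=> /reachable_pair_tr.
  move=> /reachable_restriction[k [P [L [A' [C' [kn LP AP CP]]]]]].
  apply: minABC; exists k; split=> //; exists A'^T, (B^T *m P)^T, C'^T; split.
    by apply: regressive_tr; exact: regressive_restrict LP AP (regressive_tr rA).
  have := realization_tr (realization_restrict LP AP CP (realization_tr ABC)).
  by rewrite (_ : (fun z => (G z)^T^T) = G) //; apply/funext => z; rewrite trmxK.
split=> // -[k [kn [A' [B' [C' [_ ABC']]]]]].
have := markov_dim_le (controllable_reachable hT ctrl)
  (observable_observable_pair hT obs) (fun i => realization_markov i ABC ABC').
by rewrite leqNgt kn.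
Qed.
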